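(* Let $(A,\mathcal{D})$ be a digit system with $b\geqslant 2$, let $\mathcal{F}=\mathcal{F}(A,\mathcal{D})\subset\mathbb{K}_A$, and suppose that $\mathcal{F}$ contains a nonempty open set. Let $\Delta:=\bigcup_{k=1}^{\infty}\varphi(\mathcal{D}_k-\mathcal{D}_k)$. Then: (i) There exists a set of translations $\mathcal{S}\subset\Delta$ such that $\mathcal{F}+\mathcal{S}$ tiles $\mathbb{K}_A$. Furthermore, there exists a translate $\mathcal{S}'$ of $\mathcal{S}$ such that $\mathcal{F}+\mathcal{S}'$ is an atomic self-replicating tiling of $\mathbb{K}_A$, and the expanding linear map associated to it is of the form $T=A^k$ for some sufficiently large $k$. (ii) If $\Delta$ is a group (i.e. a subgroup of $\mathbb{K}_A$), then $\mathcal{F}+\Delta$ is a tiling of $\mathbb{K}_A$.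
   Context: Let $n\geqslant 1$ and let $A\in\mathbb{Q}^{n\times n}$ be expanding (all eigenvalues have absolute value $>1$); put $B:=A^{-1}$. For an invertible $M\in\mathbb{Q}^{n\times n}$ let $\mathbb{Z}^n[M]:=\bigcup_{k\geqslant 1}(\mathbb{Z}^n+M\mathbb{Z}^n+\dots+M^{k-1}\mathbb{Z}^n)$. Put $a:=|\mathbb{Z}^n[A]/A\mathbb{Z}^n[A]|$ and $b:=|\mathbb{Z}^n[B]/B\mathbb{Z}^n[B]|$ (both finite). Representation space: let $\mathbb{Z}^n(B):=\bigcup_{k\geqslant 1}(B^{-k}\mathbb{Z}^n+B^{-k+1}\mathbb{Z}^n+\dots+B^k\mathbb{Z}^n)$. For $y\in\mathbb{Z}^n(B)$ let $\nu(y):=\inf\{k\in\mathbb{Z} : y\notin B^{k+1}\mathbb{Z}^n[B]\}\in\mathbb{Z}\cup\{\infty\}$ (with $\inf\varnothing=\infty$), and ${\bf d}_B(y,y'):=b^{-\nu(y-y')}$, with $b^{-\infty}=0$. $\mathbb{Z}^n((B))$ is the completion of $\mathbb{Z}^n(B)$ with respect to ${\bf d}_B$ (points at distance $0$ being identified); the group structure, $\nu$, ${\bf d}_B$ and multiplication by $A$ and $B$ extend to it, and elements of $\mathbb{Z}^n(B)$ are regarded as elements of $\mathbb{Z}^n((B))$ via the canonical map. $\mathbb{Z}^n[[B]]:=\{y\in\mathbb{Z}^n((B)):\nu(y)\geqslant 0\}$, and $\mu_B$ is the Haar measure on $\mathbb{Z}^n((B))$ with $\mu_B(\mathbb{Z}^n[[B]])=1$.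 Let $\mathbb{K}_A:=\mathbb{R}^n\times\mathbb{Z}^n((B))$, with metric ${\bf d}((x,y),(x',y')):=\max\{\|x-x'\|,{\bf d}_B(y,y')\}$ ($\|\cdot\|$ Euclidean) and Haar measure $\mu:=\lambda\times\mu_B$, $\lambda$ being Lebesgue measure. $A$ and its powers act by $A^k(x,y)=(A^kx,A^ky)$. Let $\varphi:\mathbb{Z}^n(B)\to\mathbb{K}_A$, $\varphi(x)=(x,x)$. A digit system is a pair $(A,\mathcal{D})$ with $A\in\mathbb{Q}^{n\times n}$ expanding and $\mathcal{D}\subset\mathbb{Z}^n[A]$, $|\mathcal{D}|=a$. $\mathcal{F}(A,\mathcal{D})\subset\mathbb{K}_A$ is the unique nonempty compact set with $A\mathcal{F}=\bigcup_{d\in\mathcal{D}}(\mathcal{F}+\varphi(d))$; explicitly $\mathcal{F}=\{\sum_{j\geqslant1}A^{-j}\varphi(d_j): d_j\in\mathcal{D}\}$. For $k\geqslant1$, $\mathcal{D}_k:=\{d_0+Ad_1+\dots+A^{k-1}d_{k-1}: d_0,\dots,d_{k-1}\in\mathcal{D}\}$ and $\mathcal{D}_k-\mathcal{D}_k:=\{d-d':d,d'\in\mathcal{D}_k\}$. For $\mathcal{S}\subset\mathbb{K}_A$, $\mathcal{F}+\mathcal{S}$ denotes the collection $\{\mathcal{F}+s: s\in\mathcal{S}\}$. It is a tiling of $\mathbb{K}_A$ (it tiles $\mathbb{K}_A$) if it covers $\mathbb{K}_A$ and $\mu((\mathcal{F}+s)\cap(\mathcal{F}+s'))=0$ for all $s\neq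 s'$ in $\mathcal{S}$. A tiling $\mathcal{F}+\mathcal{S}$ is self-replicating, with associated expanding linear map $T$ on $\mathbb{K}_A$, if for each $s\in\mathcal{S}$ there is a finite subset $J(s)\subset\mathcal{S}$ with $T(\mathcal{F}+s)=\bigcup_{s'\in J(s)}(\mathcal{F}+s')$. A self-replicating tiling is atomic if the origin $0$ belongs to exactly one tile $\mathcal{F}+s$, $s\in\mathcal{S}$. *)

(* Defs.v *)
From HB Require Import structures.
From mathcomp Require Import all_boot all_order all_algebra.
From mathcomp Require Import finmap algC.
From mathcomp Require Import zify lra ring.
From mathcomp Require Import all_classical all_reals all_analysis.
Set Implicit Arguments.
Unset Strict Implicit.
Unset Printing Implicit Defensive.
Import Order.TTheory GRing.Theory Num.Theory.
Import numFieldNormedType.Exports.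
Local Open Scope classical_set_scope.
Local Open Scope ring_scope.
Local Open Scope quotient_scope.

(* The dimension is written [n.+1], so that matrices form a unit ring and
   [M ^ j] makes sense for [j : int]. *)

Section Lattices.
Variable n : nat.
Implicit Types (M : 'M[rat]_n.+1) (x : 'cV[rat]_n.+1).

Definition expanding M :=
  forall z : algC, eigenvalue (map_mx ratr M) z -> 1 < `|z|.

Definition zvec (c : 'cV[int]_n.+1) : 'cV[rat]_n.+1 := map_mx intr c.

(* Z^n[M] *)
Definition adjoin M : set 'cV[rat]_n.+1 :=
  [set x | exists2 k : nat, (1 <= k)%N &
     exists c : nat -> 'cV[int]_n.+1, x = \sum_(i < k) M ^+ i *m zvec (c i)].

(* Z^n(M); the index [i] stands for the exponent [i - k], in [-k, k]. *)
Definition laurent M : set 'cV[rat]_n.+1 :=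
  [set x | exists2 k : nat, (1 <= k)%N &
     exists c : nat -> 'cV[int]_n.+1,
       x = \sum_(i < k.*2.+1) M ^ (i%:Z - k%:Z) *m zvec (c i)].

Definition filtr M (j : int) : set 'cV[rat]_n.+1 :=
  [set M ^ j *m x | x in adjoin M].

Definition coset_set (G H : set 'cV[rat]_n.+1) : set (set 'cV[rat]_n.+1) :=
  [set [set x + h | h in H] | x in G].

(* |Z^n[M] / M Z^n[M]|; [fset_set] sends an infinite set to the empty one, but
   the quotient is finite when M is invertible. *)
Definition residue_card M : nat :=
  #|` fset_set (coset_set (adjoin M) [set M *m x | x in adjoin M])|.

Lemma expanding_unit M : expanding M -> M \is a GRing.unit.
Proof.
move=> eM; rewrite unitmxE unitfE; apply/negP => /eqP d0.
have : eigenvalue (map_mx ratr M : 'M[algC]_n.+1) 0.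
  rewrite eigenvalue_root_char /root /char_poly -horner_evalE -det_map_mx.
  rewrite (_ : map_mx _ _ = - map_mx ratr M); last first.
    apply/matrixP => i j; rewrite !mxE /= !horner_evalE hornerD hornerN hornerC.
    by case: (i == j); rewrite ?mulr1n ?mulr0n ?hornerX ?hornerC add0r.
  by rewrite -scaleN1r detZ det_map_mx d0 rmorph0 mulr0.
by move=> /eM; rewrite normr0 ltr10.
Qed.

Lemma adjoin0 M : adjoin M 0.
Proof.
by exists 1%N => //; exists (fun=> 0); rewrite big_ord1 /zvec map_mx0 mulmx0.
Qed.

Lemma zvecB c d : zvec (c - d) = zvec c - zvec d.
Proof. by rewrite /zvec map_mxB. Qed.

Lemma zvec0 : zvec 0 = 0. Proof. exact: map_mx0. Qed.

Lemma adjoin_le M k l (c : nat -> 'cV[int]_n.+1) : (k <= l)%N ->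
  \sum_(i < k) M ^+ i *m zvec (c i) =
  \sum_(i < l) M ^+ i *m zvec (if (i < k)%N then c i else 0).
Proof.
move=> kl; rewrite (big_ord_widen l (fun i => M ^+ i *m zvec (c i)) kl).
rewrite big_mkcond /=; apply: eq_bigr => i _.
by case: ifP => // _; rewrite zvec0 mulmx0.
Qed.

Lemma adjoinB M x y : adjoin M x -> adjoin M y -> adjoin M (x - y).
Proof.
move=> [k k1 [c ->]] [l l1 [d ->]].
rewrite (adjoin_le _ _ (leq_maxl k l)) (adjoin_le _ d (leq_maxr k l)).
exists (maxn k l); first by rewrite leq_max k1.
exists (fun i => (if (i < k)%N then c i else 0) - (if (i < l)%N then d i else 0)).
by rewrite -sumrB; apply: eq_bigr => i _; rewrite zvecB mulmxBr.
Qed.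

Lemma adjoinN M x : adjoin M x -> adjoin M (- x).
Proof. by move=> ?; rewrite -sub0r; apply: adjoinB => //; exact: adjoin0. Qed.

Lemma adjoinD M x y : adjoin M x -> adjoin M y -> adjoin M (x + y).
Proof. by move=> xM yM; rewrite -[y]opprK; apply: adjoinB => //; exact: adjoinN. Qed.

Lemma adjoin_mul M x : adjoin M x -> adjoin M (M *m x).
Proof.
move=> [k k1 [c ->]]; exists k.+1 => //.
exists (fun i => if i is j.+1 then c j else 0).
rewrite big_ord_recl zvec0 mulmx0 add0r mulmx_sumr; apply: eq_bigr => i _.
by rewrite mulmxA /= exprS.
Qed.

Lemma filtr0 M j : filtr M j 0.
Proof. by exists 0; [exact: adjoin0|rewrite mulmx0]. Qed.

Lemma filtrB M j x y : filtr M j x -> filtr M j y -> filtr M j (x - y).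
Proof.
by move=> [u uM <-] [v vM <-]; exists (u - v); [exact: adjoinB|rewrite mulmxBr].
Qed.

Lemma filtrN M j x : filtr M j x -> filtr M j (- x).
Proof. by move=> ?; rewrite -sub0r; apply: filtrB => //; exact: filtr0. Qed.

Lemma filtrD M j x y : filtr M j x -> filtr M j y -> filtr M j (x + y).
Proof. by move=> xM yM; rewrite -[y]opprK; apply: filtrB => //; exact: filtrN. Qed.

Lemma adjoin_mulX M l k x :
  (exists c : nat -> 'cV[int]_n.+1, x = \sum_(i < l) M ^+ i *m zvec (c i)) ->
  exists c : nat -> 'cV[int]_n.+1,
    M ^+ k *m x = \sum_(i < k + l) M ^+ i *m zvec (c i).
Proof.
elim: k => [|k IH] xl; first by case: xl => c ->; exists c; rewrite mul1mx.
have [c Ec] := IH xl; exists (fun i => if i is j.+1 then c j else 0).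
rewrite addSn exprS -[_ * _]/(_ *m _) -mulmxA Ec.
rewrite big_ord_recl zvec0 mulmx0 add0r mulmx_sumr; apply: eq_bigr => i _.
by rewrite mulmxA /= exprS.
Qed.

Section Unit.
Variable M : 'M[rat]_n.+1.
Hypothesis Mu : M \is a GRing.unit.

Lemma filtr_mul i j x : filtr M j x -> filtr M (i + j) (M ^ i *m x).
Proof. by move=> [y yM <-]; exists y => //; rewrite exprzDr // -mulmxA. Qed.

Lemma filtr_le i j x : i <= j -> filtr M j x -> filtr M i x.
Proof.
move=> ij [y yM <-].
have [k ->] : exists k : nat, j = i + k%:Z.
  by exists `|j - i|%N; rewrite gez0_abs ?subr_ge0 // addrCA subrr addr0.
exists (M ^+ k *m y); last by rewrite mulmxA exprzDr.
by elim: k => [|k IH]; rewrite ?mul1mx // exprS -mulmxA; exact: adjoin_mul.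
Qed.

Lemma laurentP x : laurent M x <-> exists k : nat, filtr M (- k%:Z) x.
Proof.
split=> [[k k1 [c ->]]|[k [y [l l1 yl] <-]]].
  exists k, (\sum_(i < k.*2.+1) M ^+ i *m zvec (c i)).
    by exists k.*2.+1 => //; exists c.
  rewrite mulmx_sumr; apply: eq_bigr => i _.
  by rewrite addrC exprzDr // mulmxA.
pose m := maxn k l; have km : (k <= m)%N by exact: leq_maxl.
exists m; first by rewrite leq_max l1 orbT.
have [c Ec] := adjoin_mulX (m - k) yl.
have lm : ((m - k) + l <= m.*2.+1)%N.
  by rewrite -addnn -addnS leq_add ?leq_subr // leqW // leq_maxr.
rewrite (adjoin_le _ _ lm) in Ec.
exists (fun i => if (i < m - k + l)%N then c i else 0).
transitivity (M ^ (- m%:Z) *m (M ^+ (m - k) *m y)).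
  rewrite mulmxA -[M ^+ _]/(M ^ (m - k)%N%:Z) -[_ *m M ^ _]exprzDr //.
  by rewrite -subzn // addrA addNr add0r.
rewrite Ec mulmx_sumr; apply: eq_bigr => i _.
by rewrite addrC exprzDr // mulmxA.
Qed.

Lemma laurent0 : laurent M 0.
Proof. by apply/laurentP; exists 0%N; exact: filtr0. Qed.

Lemma laurentB x y : laurent M x -> laurent M y -> laurent M (x - y).
Proof.
move=> /laurentP[k xk] /laurentP[l yl]; apply/laurentP; exists (maxn k l).
by apply: filtrB; [apply: filtr_le xk|apply: filtr_le yl];
  rewrite lerN2 lez_nat ?leq_maxl ?leq_maxr.
Qed.

Lemma laurent_mul j x : laurent M x -> laurent M (M ^ j *m x).
Proof.
move=> /laurentP[k xk]; apply/laurentP; exists (k + `|j|)%N.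
apply: filtr_le (filtr_mul j xk).
by rewrite PoszD opprD addrC lerD2r abszE lerNl -normrN ler_norm.
Qed.

End Unit.
End Lattices.

(* [Z^n(B)] as a group, for [B = A^-1]. *)
Section LaurentGroup.
Variables (n : nat) (A : 'M[rat]_n.+1) (hA : expanding A).
Local Notation B := (A^-1).

Let Bu : B \is a GRing.unit.
Proof. by rewrite unitrV; exact: expanding_unit. Qed.

Definition laurent_pred : {pred 'cV[rat]_n.+1} :=
  let _ := hA in fun x => `[< laurent B x >].

Fact laurent_pred_zmod : zmod_closed laurent_pred.
Proof.
split; first by apply/asboolP/laurent0.
by move=> x y /asboolP xB /asboolP yB; apply/asboolP/laurentB.
Qed.

HB.instance Definition _ :=
  GRing.isZmodClosed.Build _ laurent_pred laurent_pred_zmod.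

Record laurentG := LaurentG {
  lval :> 'cV[rat]_n.+1;
  _ : lval \in laurent_pred }.

HB.instance Definition _ := [isSub for lval].
HB.instance Definition _ := [Choice of laurentG by <:].
HB.instance Definition _ := [SubChoice_isSubZmodule of laurentG by <:].

Lemma adjoin_laurent : adjoin A `<=` laurent B.
Proof.
move=> _ [k _ [c ->]].
have : \sum_(i < k) A ^+ i *m zvec (c i) \in laurent_pred.
  apply: rpred_sum => i _; apply/asboolP.
  have := @laurent_mul _ _ Bu (- i%:Z) (zvec (c i)).
  rewrite exprz_inv opprK -exprnP; apply; apply/(laurentP Bu).
  exists 0%N, (zvec (c i)); last by rewrite mul1mx.
  by exists 1%N => //; exists (fun=> c i); rewrite big_ord1 mul1mx.
by move=> /asboolP.
Qed.

Lemma lvalP (y : laurentG) : laurent B y.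
Proof. by case: y => y /= /asboolP. Qed.

Fact laurent_mulA_subproof (y : laurentG) : A *m y \in laurent_pred.
Proof.
apply/asboolP; have := laurent_mul Bu (-1) (lvalP y).
by rewrite exprN1 invrK.
Qed.

Definition laurent_mulA (y : laurentG) : laurentG :=
  LaurentG (laurent_mulA_subproof y).

Section Valuation.
Variable R : realType.

(* The valuation takes its values in [int] and [+oo]. *)
Definition nu (y : laurentG) : \bar R :=
  ereal_inf [set (k%:~R)%:E | k in [set k : int | ~ filtr B (k + 1) (lval y)]].

(* b^(-v), with b^(-oo) = 0; the value [-oo] is not taken by [nu]. *)
Definition bpow (v : \bar R) : R :=
  if v is r%:E then (residue_card B)%:R `^ (- r) else 0.

Definition distB (y y' : laurentG) : R := bpow (nu (y - y')).

Lemma nu0 : nu 0 = +oo%E :> \bar R.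
Proof.
rewrite /nu (_ : [set k : int | _] = set0) ?image_set0 ?ereal_inf0 //.
by rewrite -subset0 => k /=; apply; exact: filtr0.
Qed.

Lemma nuN y : nu (- y) = nu y :> \bar R.
Proof.
rewrite /nu; congr (ereal_inf [set _ | _ in _]); apply/seteqP.
split=> k /= + ky; apply; first exact: filtrN.
by rewrite -[lval y]opprK; exact: filtrN.
Qed.

Lemma le_nuD y y' : (mine (nu y) (nu y') <= nu (y + y')%R :> \bar R)%E.
Proof.
apply: le_ereal_inf_tmp => _ [k /= nk <-]; rewrite ge_min; apply/orP.
have [yk|yk] := pselect (filtr B (k + 1) (lval y)); last first.
  by left; apply: ereal_inf_lbound; exists k.
right; apply: ereal_inf_lbound; exists k => //= y'k; apply: nk.
exact: filtrD.
Qed.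

Lemma nu_gtNy y : (-oo < nu y :> \bar R)%E.
Proof.
have /(laurentP Bu)[m ym] := lvalP y.
apply: (@lt_le_trans _ _ (- (m%:R + 1))%:E); first exact: ltNyr.
apply: le_ereal_inf_tmp => _ [k /= nk <-]; rewrite lee_fin.
rewrite -[m%:R]/(m%:Z%:~R) -(intrD _ _ 1) -mulrNz ler_int.
rewrite leNgt; apply/negP => mk; apply: nk; apply: filtr_le ym => //.
lia.
Qed.

Lemma nuA y : (nu y - 1%:E <= nu (laurent_mulA y) :> \bar R)%E.
Proof.
apply: le_ereal_inf_tmp => _ [k nk <-]; rewrite leeBlDr //.
have -> : (k%:~R%:E + 1%:E)%E = (k + 1)%:~R%:E :> \bar R.
  by rewrite -EFinD intrD.
apply: ereal_inf_lbound; exists (k + 1) => //= yk; apply: nk.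
have := filtr_mul Bu (-1) yk.
by rewrite exprN1 invrK (_ : -1 + _ = k + 1) //; lia.
Qed.

End Valuation.
End LaurentGroup.

(* The completion [Z^n((B))] : Cauchy sequences modulo null sequences. The
   hypothesis [2 <= b] is a parameter of the type since [distB] is only used,
   and only shown to be a distance, in that case. *)
Section Completion.
Variables (R : realType) (n : nat) (A : 'M[rat]_n.+1) (hA : expanding A).
Hypothesis hb : (2 <= residue_card A^-1)%N.
Local Notation laurent := (laurentG hA).
Local Notation nu := (@nu n A hA R).
Local Notation bpow := (@bpow n A R).
Local Notation distB := (@distB n A hA R).

Let b_gt1 : 1 < (residue_card A^-1)%:R :> R.
Proof. by rewrite ltr1n. Qed.

Lemma bpow_ge0 v : 0 <= bpow v.
Proof. by case: v => [r| |] //=; exact: powR_ge0. Qed.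

Lemma bpow_gt0 (r : R) : 0 < bpow r%:E.
Proof. by rewrite /= powR_gt0 // (lt_trans ltr01). Qed.

Lemma le_bpow v w : (-oo < v)%E -> (v <= w)%E -> bpow w <= bpow v.
Proof.
case: v => [r| |] // _; case: w => [s| |] //; try by move=> _; exact: bpow_ge0.
by rewrite /= lee_fin => rs; apply: ler_powR; [exact: ltW|rewrite lerN2].
Qed.

Lemma lt_bpow v w : (-oo < w)%E -> bpow w < bpow v -> (v < w)%E.
Proof.
move=> w0; rewrite !ltNge => /negP wv; apply/negP => ?; apply: wv.
exact: le_bpow.
Qed.

Lemma bpow_min v w : (-oo < v)%E -> (-oo < w)%E ->
  bpow (mine v w) = Num.max (bpow v) (bpow w).
Proof.
move=> v0 w0; case: (leP v w) => [vw|/ltW wv].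
  by rewrite max_l // le_bpow.
by rewrite max_r // le_bpow.
Qed.

Lemma bpow_eq0 v : (-oo < v)%E -> bpow v = 0 -> v = +oo%E.
Proof. by case: v => [r| |] // _ r0; have := bpow_gt0 r; rewrite r0 ltxx. Qed.

Lemma distBD x x' y y' :
  distB (x + x') (y + y') <= Num.max (distB x y) (distB x' y').
Proof.
rewrite /distB -bpow_min ?nu_gtNy // le_bpow //.
  by rewrite lt_min !nu_gtNy.
by rewrite opprD addrACA le_nuD.
Qed.

Lemma distBN x y : distB (- x) (- y) = distB x y.
Proof. by rewrite /distB -opprD nuN. Qed.

Lemma distBxx x : distB x x = 0.
Proof. by rewrite /distB subrr nu0. Qed.

Definition cauchy_seq (u : nat -> laurent) : Prop :=
  forall e : R, 0 < e ->
    exists N : nat, forall i j, (N <= i)%N -> (N <= j)%N -> distB (u i) (u j) < e.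

Definition null_seq (u : nat -> laurent) : Prop :=
  forall e : R, 0 < e ->
    exists N : nat, forall i, (N <= i)%N -> distB (u i) 0 < e.

Definition cauchy_pred : {pred nat -> laurent} := 
  let _ := hb in fun u => `[< cauchy_seq u >].

Fact cauchy_pred_zmod : zmod_closed cauchy_pred.
Proof.
split; first by apply/asboolP => e e0; exists 0%N => i j _ _; rewrite distBxx.
move=> u v /asboolP cu /asboolP cv; apply/asboolP => e e0.
have [[N uN] [M vM]] := (cu e e0, cv e e0).
exists (maxn N M) => i j; rewrite !geq_max => /andP[Ni Mi] /andP[Nj Mj].
apply: le_lt_trans (distBD _ _ _ _) _; rewrite distBN gt_max uN //.
exact: vM.
Qed.

HB.instance Definition _ :=
  GRing.isZmodClosed.Build _ cauchy_pred cauchy_pred_zmod.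

Record cauchyG := CauchyG {
  cseq :> nat -> laurent;
  _ : cseq \in cauchy_pred }.

HB.instance Definition _ := [isSub for cseq].
HB.instance Definition _ := [Choice of cauchyG by <:].
HB.instance Definition _ := [SubChoice_isSubZmodule of cauchyG by <:].

Lemma cseqP (u : cauchyG) : cauchy_seq u.
Proof. by case: u => u /= /asboolP. Qed.

Definition null_pred : {pred cauchyG} := fun u => `[< null_seq u >].

Fact null_pred_zmod : zmod_closed null_pred.
Proof.
split; first by apply/asboolP => e e0; exists 0%N => i _; rewrite distBxx.
move=> u v /asboolP cu /asboolP cv; apply/asboolP => e e0.
have [[N uN] [M vM]] := (cu e e0, cv e e0).
exists (maxn N M) => i; rewrite !geq_max => /andP[Ni Mi].
rewrite -[0 in X in distB _ X](subr0 0).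
apply: le_lt_trans (distBD _ _ _ _) _; rewrite distBN gt_max uN //.
exact: vM.
Qed.

HB.instance Definition _ :=
  GRing.isZmodClosed.Build _ null_pred null_pred_zmod.

Definition completionB : Type := Quotient.quot null_pred.

HB.instance Definition _ := GRing.Zmodule.on completionB.

Definition class_of (u : cauchyG) : completionB := \pi_(Quotient.quot null_pred) u.

Definition repr_of (y : completionB) : cauchyG := repr (y : Quotient.quot null_pred).

Lemma repr_ofK y : class_of (repr_of y) = y.
Proof. exact: reprK. Qed.

Lemma class_ofP u v : class_of u = class_of v <-> null_seq (u - v).
Proof.
have -> : null_seq (u - v) <-> u - v \in null_pred.
  by split=> /asboolP.
by rewrite Quotient.idealrBE; split=> [?|/eqP//]; exact/eqP.
Qed.

Lemma class_ofB u v : class_of (u - v) = class_of u - class_of v.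
Proof. by rewrite /class_of Quotient.pi_add Quotient.pi_opp. Qed.

(* The continuous extension of [nu]. *)
Definition nuC (y : completionB) : \bar R := limn (fun k => nu (repr_of y k)).

Definition distC (y y' : completionB) : R := bpow (nuC (y - y')).

Lemma nu_eq x y : (nu x < nu (x - y)%R)%E -> nu y = nu x.
Proof.
move=> xy; apply/eqP; rewrite eq_le; apply/andP; split; last first.
  by have := le_nuD R x (- (x - y)); rewrite subKr nuN min_l // ltW.
have E : y + (x - y) = x by rewrite addrC subrK.
have := le_nuD R y (x - y); rewrite E ge_min => /orP[//|].
by rewrite leNgt xy.
Qed.

Lemma null_nu_cvg u : null_seq u -> nu (u k) @[k --> \oo] --> +oo%E.
Proof.
move=> u0; apply/cvgeyPgt => r; have [N uN] := u0 _ (bpow_gt0 r).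
exists N => // k /= Nk; apply: lt_bpow; first exact: nu_gtNy.
by have := uN _ Nk; rewrite /distB subr0.
Qed.

Lemma nu_cauchy (u : cauchyG) :
  null_seq u \/ exists r : R, \forall k \near \oo, nu (u k) = r%:E.
Proof.
have [?|/existsNP[e /not_implyP[e0 /forallNP ue]]] := pselect (null_seq u);
  [by left|right].
have [N uN] := cseqP u e0.
have [k /not_implyP[Nk /negP]] := (existsNP _).2 (ue N); rewrite -leNgt /distB subr0 => ek.
case E : (nu (u k)) ek => [r| |] /= ek.
- exists r; exists N => // j /= Nj; rewrite -E; apply: nu_eq.
  apply: lt_bpow; first exact: nu_gtNy.
  by apply: lt_le_trans (uN k j Nk Nj) _; rewrite E.
- by move: e0; rewrite ltNge ek.
- by have := nu_gtNy R (u k); rewrite E.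
Qed.

Lemma nu_cauchy_cvg (u : cauchyG) : cvgn (fun k => nu (u k)).
Proof.
have [/null_nu_cvg u0|[r ur]] := nu_cauchy u.
  by apply/cvg_ex; exists +oo%E.
exact: is_cvg_near_cst ur.
Qed.

Lemma nuC_class u : nuC (class_of u) = limn (fun k => nu (u k)).
Proof.
rewrite /nuC; set v := repr_of _.
have uv : null_seq (u - v) by apply/class_ofP; rewrite repr_ofK.
have [u0|[r ur]] := nu_cauchy u.
  have v0 : null_seq v.
    have : u - (u - v) \in null_pred by apply: rpredB; exact/asboolP.
    by rewrite subKr => /asboolP.
  by rewrite (cvg_lim _ (null_nu_cvg u0)) // (cvg_lim _ (null_nu_cvg v0)).
have vr : \forall k \near \oo, nu (v k) = r%:E.
  have /cvgeyPgt/(_ r) := null_nu_cvg uv; apply: filterS2 ur => k ur kr.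
  by rewrite -ur; apply: nu_eq; rewrite ur.
by rewrite (cvg_lim _ (cvg_near_cst _ ur)) // (cvg_lim _ (cvg_near_cst _ vr)).
Qed.

Lemma nuC_gtNy y : (-oo < nuC y)%E.
Proof.
have [/null_nu_cvg u0|[r ur]] := nu_cauchy (repr_of y).
  by rewrite /nuC (cvg_lim _ u0).
by rewrite /nuC (cvg_lim _ (cvg_near_cst _ ur)) // ltNyr.
Qed.

Lemma lt_nuC (r : R) y : (r%:E < nuC y)%E ->
  \forall k \near \oo, (r%:E < nu (repr_of y k))%E.
Proof.
have [/null_nu_cvg/cvgeyPgt/(_ r)//|[s ys]] := nu_cauchy (repr_of y).
rewrite /nuC (cvg_lim _ (cvg_near_cst _ ys)) // => rs.
by apply: filterS ys => k ->.
Qed.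

Lemma class_ofN u : class_of (- u) = - class_of u.
Proof. by rewrite /class_of Quotient.pi_opp. Qed.

Lemma class_ofD u v : class_of (u + v) = class_of u + class_of v.
Proof. by rewrite /class_of Quotient.pi_add. Qed.

Lemma class_of0 : class_of 0 = 0.
Proof. by rewrite -(subrr (0 : cauchyG)) class_ofB subrr. Qed.

Lemma nuC0 : nuC 0 = +oo%E.
Proof.
rewrite -class_of0 nuC_class; apply: cvg_lim => //.
by apply: cvg_near_cst; apply: nearW => k; exact: nu0.

Qed.

Lemma nuCN y : nuC (- y) = nuC y.
Proof.
rewrite -[y]repr_ofK -class_ofN !nuC_class; congr (limn _).
by apply/funext => k; exact: nuN.
Qed.

Lemma nuC_eqy y : nuC y = +oo%E -> y = 0.
Proof.
have [u0 _|[r ur]] := nu_cauchy (repr_of y); last first.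
  by rewrite /nuC (cvg_lim _ (cvg_near_cst _ ur)).
by rewrite -[y]repr_ofK -class_of0; apply/class_ofP; rewrite subr0.
Qed.

Lemma le_nuCD y y' : (mine (nuC y) (nuC y') <= nuC (y + y')%R)%E.
Proof.
rewrite leNgt; apply/negP.
have -> : nuC (y + y') = limn (fun k => nu (repr_of y k + repr_of y' k)).
  by rewrite -{1}[y]repr_ofK -{1}[y']repr_ofK -class_ofD nuC_class.
have [/null_nu_cvg u0|[r ur]] := nu_cauchy (repr_of y + repr_of y').
  by rewrite (cvg_lim _ u0) // ltNge leey.
rewrite (cvg_lim _ (cvg_near_cst _ ur)) // lt_min => /andP[/lt_nuC yr /lt_nuC y'r].
have : \forall k \near \oo, False; last by case=> N _ /(_ N (leqnn _)).
near=> k; have := le_nuD R (repr_of y k) (repr_of y' k).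
apply/negP; rewrite -ltNge lt_min.
have -> : nu (repr_of y k + repr_of y' k) = r%:E by near: k; exact: ur.
by apply/andP; split; near: k.
Unshelve. all: by end_near. Qed.

Fact distCxx y : distC y y = 0.
Proof. by rewrite /distC subrr nuC0. Qed.

Fact distC_eq0 y y' : distC y y' = 0 -> y = y'.
Proof.
by move=> /(bpow_eq0 (nuC_gtNy _))/nuC_eqy/eqP; rewrite subr_eq0 => /eqP.
Qed.

Fact distC_sym y y' : distC y y' = distC y' y.
Proof. by rewrite /distC -nuCN opprB. Qed.

Lemma distC_ultra y x z : distC x z <= Num.max (distC x y) (distC y z).
Proof.
rewrite /distC -bpow_min ?nuC_gtNy // le_bpow //.
  by rewrite lt_min !nuC_gtNy.
by rewrite (_ : x - z = (x - y) + (y - z)) ?le_nuCD // addrA subrK.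
Qed.

Fact distC_triangle y x z : distC x z <= distC x y + distC y z.
Proof.
apply: le_trans (distC_ultra y x z) _.
by rewrite ge_max lerDl lerDr !bpow_ge0.
Qed.

HB.instance Definition _ := isPointed.Build completionB 0.
HB.instance Definition _ := isMetric.Build R completionB
  distCxx distC_eq0 distC_sym distC_triangle.

Fact cauchy_const_subproof (y : laurent) : cst y \in cauchy_pred.
Proof. by apply/asboolP => e e0; exists 0%N => i j _ _; rewrite distBxx. Qed.

Definition embed (y : laurent) : completionB :=
  class_of (CauchyG (cauchy_const_subproof y)).

Lemma nuC_embed y : nuC (embed y) = nu y.
Proof. by rewrite nuC_class; apply: cvg_lim => //; apply: cvg_near_cst; apply: nearW. Qed.

Lemma laurent_mulAB (x y : laurent) :
  laurent_mulA x - laurent_mulA y = laurent_mulA (x - y).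
Proof. by apply: val_inj; rewrite /= mulmxBr. Qed.

Lemma distB_mulA x y :
  distB (laurent_mulA x) (laurent_mulA y) <= distB x y * (residue_card A^-1)%:R.
Proof.
have b0 : 0 < (residue_card A^-1)%:R :> R by rewrite (lt_trans ltr01).
rewrite /distB laurent_mulAB.
have := nuA R (x - y); have := nu_gtNy R (x - y).
set v := nu (x - y); set w := nu (laurent_mulA _) => v0 vw.
have -> : bpow v * (residue_card A^-1)%:R = bpow (v - 1%:E)%E.
  case: v v0 {vw} => [r| |] //= _; last by rewrite mul0r.
  by rewrite opprB addrC powRD ?powRr1 ?(ltW b0) // lt0r_neq0 ?implybT.
by apply: le_bpow vw; case: v v0 => //= r _; exact: ltNyr.
Qed.

Fact cauchy_mulA_subproof (u : cauchyG) :
  (fun k => laurent_mulA (u k)) \in cauchy_pred.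
Proof.
have b0 : 0 < (residue_card A^-1)%:R :> R by rewrite (lt_trans ltr01).
apply/asboolP => e e0; have [N uN] := cseqP u (divr_gt0 e0 b0).
exists N => i j Ni Nj; apply: le_lt_trans (distB_mulA _ _) _.
by rewrite -ltr_pdivlMr // uN.
Qed.

Definition cauchy_mulA (u : cauchyG) : cauchyG :=
  CauchyG (cauchy_mulA_subproof u).

(* Multiplication by [A], extended to the completion. *)
Definition mulA (y : completionB) : completionB :=
  class_of (cauchy_mulA (repr_of y)).

Lemma mulA_class u : mulA (class_of u) = class_of (cauchy_mulA u).
Proof.
have b0 : 0 < (residue_card A^-1)%:R :> R by rewrite (lt_trans ltr01).
apply/class_ofP => e e0.
have /class_ofP uv : class_of (repr_of (class_of u)) = class_of u.
  exact: repr_ofK.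
have [N uN] := uv _ (divr_gt0 e0 b0); exists N => i Ni.
have := uN i Ni; rewrite ltr_pdivlMr //; apply: le_lt_trans.
rewrite /distB !subr0; apply: le_trans (distB_mulA _ _).
by rewrite /distB.
Qed.

Lemma mulA_embed y : mulA (embed y) = embed (laurent_mulA y).
Proof. by rewrite mulA_class; congr class_of; exact: val_inj. Qed.

(* Z^n[[B]] *)
Definition integersB : set completionB := [set y | (0 <= nuC y)%E].

(* The space [K_A = R^n * Z^n((B))], with the product topology. *)
Definition KA : Type := ('cV[R]_n.+1 * completionB)%type.

Definition phi (x : laurent) : KA := (map_mx ratr (lval x), embed x).

Definition actA (z : KA) : KA := (map_mx ratr A *m z.1, mulA z.2).

Definition euclid_norm (x : 'cV[R]_n.+1) : R :=
  Num.sqrt (\sum_i x i ord0 ^+ 2).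

Definition distK (z z' : KA) : R :=
  Num.max (euclid_norm (z.1 - z'.1)) (distC z.2 z'.2).

(* The topology of [KA] is the one defined by the distance [distK]. *)
Lemma nbhs_KAP (z : KA) (U : set KA) :
  nbhs z U <-> exists2 e : R, 0 < e & forall z', distK z z' < e -> U z'.
Proof.
have le_eu (x : 'cV[R]_n.+1) i : `|x i ord0| <= euclid_norm x.
  rewrite /euclid_norm -sqrtr_sqr ler_sqrt ?sumr_ge0 // => [|j _].
    by rewrite (bigD1 i) //= lerDl sumr_ge0 // => j _; exact: sqr_ge0.
  exact: sqr_ge0.
have eu_lt (x : 'cV[R]_n.+1) e : 0 < e ->
    (forall i, `|x i ord0| < e / (2 * n.+1%:R)) -> euclid_norm x < e.
  move=> e0; set d := e / _ => xd.
  have N1 : 1 <= n.+1%:R :> R by rewrite ler1n.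
  have dN : d * n.+1%:R = e / 2.
    by rewrite /d; field; rewrite lt0r_neq0 // (lt_le_trans ltr01).
  have d0 : 0 < d by rewrite divr_gt0 // mulr_gt0 // (lt_le_trans ltr01).
  have de : d <= e / 2 by rewrite -dN ler_peMr // ltW.
  rewrite -[ltRHS]ger0_norm ?(ltW e0) // -sqrtr_sqr ltr_sqrt ?exprn_gt0 //.
  apply: (@le_lt_trans _ _ (\sum_(i < n.+1) d ^+ 2)).
    apply: ler_sum => i _; rewrite -[leLHS]real_normK ?num_real //.
    by rewrite lerXn2r ?nnegrE ?(ltW d0) // ltW.
  rewrite sumr_const card_ord -[_ *+ _]mulr_natr expr2 -mulrA dN.
  by nra.
apply: (iff_trans (nbhs_ballP z U)); split=> [[e /= e0 zU]|[e e0 zU]].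
  exists e => // z'; rewrite /distK gt_max => /andP[z1 z2]; apply: zU; split => /=.
    split=> // i j; rewrite (ord1 j) /ball /=; apply: le_lt_trans z1.
    by apply: le_trans (le_eu _ i); rewrite !mxE.
  by rewrite ballEmdist.
exists (e / (2 * n.+1%:R)) => /=.
  by rewrite divr_gt0 // mulr_gt0 // ltr0n.
move=> z' [/= [_ z1] z2]; apply: zU; rewrite /distK gt_max; apply/andP; split.
  by apply: eu_lt => // i; have := z1 i ord0; rewrite /ball /= !mxE.
move: z2; rewrite ballEmdist /= => /lt_le_trans; apply.
rewrite ler_pdivrMr ?mulr_gt0 ?ltr0n // ler_peMr ?(ltW e0) //.
by rewrite -natrM ler1n.
Qed.

End Completion.

Arguments lval {n A hA}.
Arguments integersB R {n A} hA hb.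
Arguments phi R {n A} hA hb.
Arguments actA {R n A hA hb}.

Notation borel T := (g_sigma_algebraType (@open T)).

Section Measures.

(* Lebesgue measure on R^(n.+1), as the unique Borel measure with the right
   values on boxes. *)
Definition is_lebesgue (R : realType) (n : nat)
    (lambda : {measure set (borel 'cV[R]_n.+1) -> \bar R}) : Prop :=
  forall a b : 'cV[R]_n.+1, (forall i, a i ord0 <= b i ord0) ->
    lambda [set x : 'cV[R]_n.+1 | forall i, a i ord0 <= x i ord0 <= b i ord0] =
    (\prod_i (b i ord0 - a i ord0))%:E.

Section Haar.
Variables (R : realType) (n : nat) (A : 'M[rat]_n.+1) (hA : expanding A).
Variable hb : (2 <= residue_card A^-1)%N.
Variable muB : {measure set (borel (completionB R hA hb)) -> \bar R}.

(* No regularity condition is needed: [completionB] is second countable and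
   locally compact. *)
Definition haar : Prop :=
  [/\ forall K : set (completionB R hA hb), compact K -> (muB K < +oo)%E,
      forall (t : completionB R hA hb) (E : set (borel (completionB R hA hb))),
        measurable E -> muB [set y + t | y in E] = muB E
    & muB [set: completionB R hA hb] != 0%E].
End Haar.
End Measures.

Section Tilings.
Variables (R : realType) (V : zmodType).
Implicit Types (mu : set V -> \bar R) (F S : set V) (T : V -> V).

Definition translate F (s : V) : set V := [set z + s | z in F].

Definition tiling mu F S : Prop :=
  \bigcup_(s in S) translate F s = setT /\
  forall s s', S s -> S s' -> s <> s' ->
    mu (translate F s `&` translate F s') = 0%E.

Definition self_replicating mu F S T : Prop :=
  tiling mu F S /\
  forall s, S s -> exists J : set V,
    [/\ finite_set J, J `<=` S &
        T @` translate F s = \bigcup_(s' in J) translate F s'].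

Definition atomic F S : Prop := exists! s, S s /\ translate F s 0.

Definition subgroup (G : set V) : Prop :=
  G 0 /\ forall x y, G x -> G y -> G (x - y).

End Tilings.

Section DigitSystems.
Variables (R : realType) (n : nat) (A : 'M[rat]_n.+1).

Definition digit_set (D : set 'cV[rat]_n.+1) : Prop :=
  D `<=` adjoin A /\ (D #= `I_(residue_card A))%card.

Definition expansions (D : set 'cV[rat]_n.+1) (k : nat) : set 'cV[rat]_n.+1 :=
  [set x | exists2 d : nat -> 'cV[rat]_n.+1, (forall i, (i < k)%N -> D (d i)) &
     x = \sum_(i < k) A ^+ i *m d i].

Variables (hA : expanding A) (hb : (2 <= residue_card A^-1)%N).
Local Notation KA := (KA R hA hb).
Local Notation phi := (phi R hA hb).

(* The preimage by [lval] views [D] as a part of [Z^n(B)]; nothing is lost, by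
   [adjoin_laurent]. *)
Definition rational_tile (D : set 'cV[rat]_n.+1) (F : set KA) : Prop :=
  [/\ compact F, F !=set0 &
      actA @` F = \bigcup_(d in lval @^-1` D) translate F (phi d)].

Definition Delta (D : set 'cV[rat]_n.+1) : set KA :=
  \bigcup_(k in [set k : nat | (1 <= k)%N])
    [set phi x | x in [set x : laurentG hA |
       exists d d', [/\ expansions D k d, expansions D k d' & lval x = d - d']]].

End DigitSystems.

Arguments Delta R {n A} hA hb D.

(* Main.v *)
(* Let c be the factor by which A scales the Haar measure of K_A (uniqueness of Haar
   measure gives its existence) and let Gamma = phi(Z^n[A]), a discrete subgroup with
   [Gamma : A Gamma] = a. Since F + Gamma covers, any Gamma-packing P has
   mu(P) <= mu(F); replacing P by A^-1 of the union of its translates by representatives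
   of Gamma / A Gamma yields a packing of measure (a / c) mu(P), so a <= c. Hence
   c mu(F) = mu(A F) <= a mu(F) leaves no room for overlaps of the translates F + phi(d)
   with d in D, nor, by induction, with d in D_k. Finally choose p in the interior of F
   with A^k p = p + phi(d), d in D_k: the inflations A^(ki)(F - p) exhaust K_A, and each is
   a part of the next, which gives the atomic self-replicating tiling. *)

Require Import Defs.
From HB Require Import structures.
From mathcomp Require Import all_boot all_order all_algebra.
From mathcomp Require Import finmap algC zify lra ring.
From mathcomp Require Import all_classical all_reals all_analysis measurable_realfun.
Set Implicit Arguments.
Unset Strict Implicit.
Unset Printing Implicit Defensive.
Import Order.TTheory GRing.Theory Num.Theory.
Import numFieldNormedType.Exports.
Local Open Scope classical_set_scope.
Local Open Scope ring_scope.

(** * Uniqueness of Haar measure *)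

(** The factor c is never computed: it is enough that A multiplies mu by some constant, and the
    inequality a <= c takes the place of a determinant formula. Discreteness of Gamma is arithmetic.
    An element of Z^n[A] whose second coordinate has valuation at least 0 lies in the intersection
    of Z^n[A] and Z^n[B]; this intersection has bounded denominators, so a small real coordinate
    forces the element to vanish. The covering by F + Gamma and the point p both come from an open
    subset of F. Since A^-1 contracts both factors, some piece A^-k (F + d) of F lies in that open
    set, and p is the fixed point of the corresponding contraction. A periodic p is preferred to any
    other interior point because A^k p = p + d, with d in D_k, makes -p - A^(ki) (-p) an element of
    D_(ki). The tiles of A^(ki) (F - p) + p are then translates of F by elements of D_(ki) - D_(ki),
    which is how Delta enters. Conversely, every element of Delta is some x - y with x, y in D_m; if
    Delta is a group, two of its tiles are a common translate of F + x and F + y, which settles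
    (ii). *)

Section HaarUniqueness.
Local Open Scope ereal_scope.
Context d (G : measurableType d) (R : realType).
Variables (add : G -> G -> G) (opp : G -> G).
Hypotheses (addC : commutative add) (oppK : involutive opp).
Hypothesis addNK : forall x y, add (opp x) (add x y) = y.
Hypothesis oppD : forall x y, opp (add x y) = add (opp x) (opp y).
Hypothesis add_measurable : measurable_fun setT (fun z : G * G => add z.1 z.2).
Hypothesis opp_measurable : measurable_fun setT opp.

(** The group law is a plain function because the sigma-algebra of [K_A] is that of a product of two
    Borel spaces, while addition belongs to the topological group with the same points. *)
Definition invariant_measure (m : set G -> \bar R) :=
  forall t E, measurable E -> m (add t @^-1` E) = m E.

Variables m1 m2 : {sigma_finite_measure set G -> \bar R}.
Hypotheses (inv1 : invariant_measure m1) (inv2 : invariant_measure m2).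

(* Weil's argument: compute the double integral of [1_E(x) 1_F(x + y)] in both orders. *)
Lemma invariant_measure_exchange E F : measurable E -> measurable F ->
  m1 E * m2 F = m1 F * m2 (opp @^-1` E).
Proof.
move=> mE mF.
have prodC X : measurable X -> (m1 \x m2) X = (m1 \x^ m2) X.
  by move=> mX; apply: product_measure_unique => //= ? ? ? ?; rewrite product_measure2E.
have mpre (f : G * G -> G) A : measurable_fun setT f -> measurable A ->
  measurable (f @^-1` A) by move=> mf mA; rewrite -[X in measurable X]setTI; exact: mf.
(* For fixed [y], substituting [x - y] for [x] turns the section of [P] into that of [Q]; for fixed
   [x] in [F], substituting [x + y] for [y] turns the section of [Q] into [- E]. *)
pose P := (fst @^-1` E) `&` ((fun z => add z.1 z.2) @^-1` F) : set (G * G).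
pose Q := ((fun z => add (opp z.2) z.1) @^-1` E) `&` (fst @^-1` F) : set (G * G).
have mP : measurable P.
  by apply: measurableI; [exact: (mpre fst)|exact: (mpre _ _ add_measurable)].
have mQ : measurable Q.
  apply: measurableI; last exact: (mpre fst).
  apply: (mpre (fun z => add (opp z.2) z.1)) => //.
  apply: (measurableT_comp add_measurable (g := fun z : G * G => (opp z.2, z.1))).
  apply: measurable_fun_pair; last exact: measurable_fst.
  exact: (measurableT_comp opp_measurable measurable_snd).
have intE A c : measurable A -> \int[m1]_x ((\1_A x)%:E * m2 c) = m1 A * m2 c.
  move=> mA; rewrite ge0_integralZr ?integral_indic ?setIT //.
  exact/measurable_EFinP/measurable_indic.
transitivity ((m1 \x m2) P).
  rewrite -(intE _ _ mE); apply: eq_integral => x _ /=.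
  rewrite indicE; have [xE|xE] := boolP (x \in E).
    rewrite mul1e -(inv2 x mF); congr (m2 _); apply/seteqP.
    rewrite inE in xE.
    split=> y /=; rewrite /xsection /= inE; first by split.
    by case.
  rewrite mul0e (_ : xsection _ _ = set0) ?measure0 //.
  rewrite -subset0 => y /=; rewrite /xsection /= inE /P /= => -[xE' _].
  by move/negP: xE; apply; rewrite inE.
rewrite prodC //; transitivity ((m1 \x^ m2) Q).
  apply: eq_integral => y _ /=; rewrite -(inv1 (opp y)); last exact: measurable_ysection.
  have E1 x : add (add (opp y) x) y = x by rewrite addC -[X in add X _]oppK addNK.
  by congr (m1 _); apply/seteqP; split=> x /=; rewrite /ysection /= !inE /P /Q /= E1.
rewrite -prodC // -(intE _ _ mF); apply: eq_integral => x _ /=.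
rewrite indicE; have [xF|xF] := boolP (x \in F).
  rewrite mul1e -(inv2 x); last exact: measurable_xsection.
  rewrite inE in xF.
  have E1 y : add (opp (add x y)) x = opp y.
    by rewrite oppD addC -[X in add X _]oppK addNK.
  congr (m2 _); apply/seteqP; split=> y /=; rewrite /xsection /= inE /Q /= E1.
    by case.
  by split.
rewrite mul0e (_ : xsection _ _ = set0) ?measure0 //.
rewrite -subset0 => y /=; rewrite /xsection /= inE /Q /= => -[_ xF'].
by move/negP: xF; apply; rewrite inE.
Qed.

End HaarUniqueness.

(** * Borel sets of products *)

Section BorelProduct.

Lemma countable_range T (D : set T) : countable D -> D !=set0 ->
  exists f : nat -> T, D = range f.
Proof.
move=> /pfcard_geP[->[]//|[f] _]; exists f; apply/seteqP; split=> [x Dx|_ [k _ <-]].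
  by have [k _ <-] := @surj _ _ _ _ f _ Dx; exists k.
exact: funS.
Qed.

Lemma countable_bigcup_measurable d (T : measurableType d) I (D : set I)
  (F : I -> set T) : countable D -> (forall i, D i -> measurable (F i)) ->
  measurable (\bigcup_(i in D) F i).
Proof.
move=> cD mF; have [->|D0] := eqVneq D set0; first by rewrite bigcup_set0.
have [|f Df] := @countable_range _ D cD; first by apply/set0P.
rewrite Df bigcup_image; apply: bigcupT_measurable => k; apply: mF.
by rewrite Df; exists k.
Qed.

Lemma open_borel (X : ptopologicalType) (O : set X) :
  open O -> measurable (O : set (borel X)).
Proof. by move=> oO; exact: sub_sigma_algebra. Qed.

Lemma closed_borel (X : ptopologicalType) (F : set X) :
  closed F -> measurable (F : set (borel X)).
Proof.
move=> cF; rewrite -[F]setCK; apply: measurableC; apply: open_borel.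
exact: closed_openC.
Qed.

Lemma second_countable_dense (R : realType) (X : pseudoMetricType R) (D : set X) :
  countable D -> (forall x e, 0 < e -> exists2 q, D q & ball x e q) ->
  @second_countable X.
Proof.
move=> cD dD.
pose f n (z : X) : set X := (ball z (n.+1%:R^-1 : R))°.
exists (\bigcup_n [set f n z | z in D]); [|split].
- by apply: bigcup_countable => // n _; exact: sub_countable (card_image_le _ _) _.
- by move=> ? [? _ [? _ <-]]; exact: open_interior.
- move=> x V /nbhs_ballP[_/posnumP[eps] epsV].
  have [//|N] := @ltr_add_invr R 0%R (eps%:num / 2) _; rewrite add0r => Neps.
  have N0 : 0 < (N.+1%:R^-1 : R) by [].
  have N20 : 0 < (N.+1%:R^-1 / 2 : R) by rewrite divr_gt0.
  have [w Dw xw] := dD x _ N20.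
  exists (f N w); first split=> //; first by exists N => //; exists w.
    apply/nbhs_ballP; exists (N.+1%:R^-1 / 2) => //= y xy.
    rewrite [X in ball _ X _]splitr; apply: ball_triangle xy.
    exact: ball_sym.
  apply: subset_trans epsV => z /interior_subset wz.
  rewrite [_%:num]splitr; apply: (@ball_triangle _ _ w).
    apply: le_ball xw; apply: le_trans (ltW Neps).
    by rewrite ler_pdivrMr // ler_peMr ?ler1n ?invr_ge0.
  by apply: le_ball wz; exact: ltW.
Qed.

(** The measure on [K_A] lives on the product of two Borel sigma-algebras. Second countability
    writes an open set as a countable union of open rectangles, so closed and compact sets of [K_A]
    become measurable too. *)
Lemma open_prod_measurable (X Y : ptopologicalType) (O : set (X * Y)) :
  @second_countable X -> @second_countable Y -> open O ->
  measurable (O : set (borel X * borel Y)%type).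
Proof.
move=> [BX cX [oX bX]] [BY cY [oY bY]] oO.
pose I := [set UV : set X * set Y | [/\ BX UV.1, BY UV.2 & UV.1 `*` UV.2 `<=` O]].
have -> : O = \bigcup_(UV in I) (UV.1 `*` UV.2).
  apply/seteqP; split=> [[x y] Oxy|z [UV [_ _ UVO] UVz]]; last exact: UVO.
  have [[/= P Q] [xP yQ] PQO] : nbhs (x, y) O by exact: open_nbhs_nbhs.
  have [U [BU Ux] UP] := bX _ _ xP; have [V [BV Vy] VQ] := bY _ _ yQ.
  exists (U, V) => //; split=> // -[x' y'] [/= ? ?]; apply: PQO.
  by split; [exact: UP|exact: VQ].
apply: countable_bigcup_measurable => [|[U V] [/= BU BV _]].
  by apply: sub_countable (countableX cX cY); apply: subset_card_le => -[? ?] [? ? _].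
by apply: measurableX; apply: open_borel; [exact: oX|exact: oY].
Qed.

Lemma continuous_borel (X Y : ptopologicalType) (f : X -> Y) : continuous f ->
  measurable_fun setT (f : borel X -> borel Y).
Proof.
move=> /continuousP cf.
apply: (@measurability _ _ (borel X) (borel Y) _ _ (@open Y)) => // _ [U oU <-].
by rewrite setTI; apply: open_borel; exact: cf.
Qed.

Lemma continuous2_borel (X Y Z : ptopologicalType) (f : X * Y -> Z) :
  @second_countable X -> @second_countable Y -> continuous f ->
  measurable_fun setT (f : borel X * borel Y -> borel Z).
Proof.
move=> cX cY /continuousP cf.
apply: (@measurability _ _ (borel X * borel Y)%type (borel Z) _ _ (@open Z)) => // _ [U oU <-].
by rewrite setTI; apply: open_prod_measurable => //; exact: cf.
Qed.

End BorelProduct.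

(** * Contraction by the inverse matrix *)

Section Decay.
Variable n : nat.

(** Induction on the roots through [M^(k+1) X = z M^k X + M^k (M - z) X]. If [C r^k] bounds the
    entries of the last term, any [C' >= C / (r - |z|)] satisfies [|z| C' + C <= r C'] and
    propagates; [S] covers the case [k = 0]. Multiple roots are harmless because [|z| < r] is
    strict. *)
Lemma decay_of_annihilator (M X : 'M[algC]_n.+1) (s : seq algC) (r : algC) :
  (forall z, z \in s -> `|z| < r) -> 0 <= r ->
  horner_mx M (\prod_(z <- s) ('X - z%:P)) * X = 0 ->
  exists2 C : algC, 0 <= C & forall k i j, `|(M ^+ k * X) i j| <= C * r ^+ k.
Proof.
elim: s X => [|z s IH] X sr r0.
  rewrite big_nil rmorph1 mul1r => ->; exists 0 => // k i j.
  by rewrite mulr0 mxE normr0 mul0r.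
rewrite big_cons mulrC rmorphM /= -mulrA.
rewrite rmorphB /= horner_mx_X horner_mx_C => sX.
have [z' zs|C C0 CP] := IH _ _ r0 sX; first by apply: sr; rewrite inE zs orbT.
have zr : 0 < r - `|z| by rewrite subr_gt0 sr // inE eqxx.
pose S := \sum_i \sum_j `|X i j|.
have S0 : 0 <= S by apply: sumr_ge0 => i _; apply: sumr_ge0.
have SX i j : `|X i j| <= S.
  rewrite /S (bigD1 i) //= (bigD1 j) //= -addrA lerDl addr_ge0 ?sumr_ge0 //.
  by move=> *; apply: sumr_ge0.
exists (S + C / (r - `|z|)); first by rewrite addr_ge0 // divr_ge0 // ltW.
have Cz0 : 0 <= C / (r - `|z|) by rewrite divr_ge0 // ltW.
elim=> [|k IHk] i j; first by rewrite mul1r mulr1 (le_trans (SX i j)) // lerDl.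
have -> : M ^+ k.+1 * X = z *: (M ^+ k * X) + M ^+ k * ((M - z%:M) * X).
  rewrite mulrBl mulrBr !mulrA -exprSr -[in X in _ - X]mulrA.
  rewrite -[z%:M * X]/(z%:M *m X) mul_scalar_mx.
  by rewrite -[_ * (z *: X)]/(_ *m (z *: X)) -scalemxAr addrC subrK.
rewrite mxE (le_trans (ler_normD _ _)) //.
apply: (le_trans (lerD _ (CP k i j))).
  by rewrite mxE normrM; apply: (ler_wpM2l _ (IHk i j)).
rewrite mulrA -mulrDl exprS [leRHS]mulrA ler_wpM2r ?exprn_ge0 //.
rewrite [leRHS]mulrC -lerBrDl -mulrBl mulrDr mulrCA divff ?gt_eqF // mulr1.
by rewrite lerDr mulr_ge0 // ltW.
Qed.

(** The eigenvalues of [A^-1] are inverses of eigenvalues of [A], hence lie in the open unit disc,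
    and Cayley-Hamilton supplies the annihilator. A rate of the form [N / (N + 1)] keeps the bound
    rational, so that it passes from the algebraic numbers to [R]. *)
Lemma expanding_decay (A : 'M[rat]_n.+1) : expanding A ->
  exists C N : nat, forall k i j,
    `|(A^-1 ^+ k) i j| <= C%:R * (N%:R / N.+1%:R) ^+ k.
Proof.
move=> hA; have Au := expanding_unit hA.
pose M : 'M[algC]_n.+1 := map_mx ratr A^-1.
have [s sE] := closed_field_poly_normal (char_poly M).
rewrite (monicP (char_poly_monic M)) scale1r in sE.
have s1 z : z \in s -> `|z| < 1.
  move=> zs; have : eigenvalue M z.
    by rewrite eigenvalue_root_char sE root_prod_XsubC.
  move=> /eigenvalueP[v vM v0].
  have MA : M *m map_mx ratr A = 1%:M.
    by rewrite /M -map_mxM -[_ *m _]/(_ * _) mulVr // map_mx1.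
  have vE : v = z *: (v *m map_mx ratr A).
    by rewrite scalemxAl -vM -mulmxA MA mulmx1.
  have z0 : z != 0 by apply: contra_neq v0 => z0; rewrite vE z0 scale0r.
  have : eigenvalue (map_mx ratr A) z^-1.
    by apply/eigenvalueP; exists v => //; rewrite {2}vE scalerA mulVf // scale1r.
  by move=> /hA; rewrite normfV invf_gt1 // normr_gt0.
have [N NP] : exists N : nat, forall z, z \in s -> `|z| < N%:R / N.+1%:R.
  have mono a b : (a <= b)%N -> a%:R / a.+1%:R <= b%:R / b.+1%:R :> algC.
    move=> ab; rewrite ler_pdivrMr ?ltr0n // mulrAC ler_pdivlMr ?ltr0n //.
    by rewrite -!natrM ler_nat; nia.
  elim: s s1 {sE} => [|z s IH] s1; first by exists 0%N.
  have [|N NP] := IH; first by move=> z' ?; apply: s1; rewrite inE orbC; apply/orP; left.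
  have z1 : 0 < 1 - `|z| by rewrite subr_gt0 s1 // inE eqxx.
  (* [m > 1 / (1 - |z|)] gives [m (1 - |z|) > 1 > |z|], that is, [|z| < m / (m + 1)]. *)
  have := archi_boundP (ltW (divr_gt0 ltr01 z1)); set m := Num.bound _ => zm.
  exists (maxn m N) => z'; rewrite inE => /orP[/eqP->|/NP /lt_le_trans]; last first.
    by apply; apply: mono; exact: leq_maxr.
  apply: (lt_le_trans _ (mono _ _ (leq_maxl m N))).
  rewrite ltr_pdivrMr // mulrBr mulr1 in zm; rewrite ltr_pdivlMr ?ltr0n // -natr1.
  have : `|z| < 1 by apply: s1; rewrite inE eqxx.
  rewrite mulrC mulrDl mul1r => z2; rewrite -(ltrD2l (- (m%:R * `|z|))) addKr.
  by rewrite addrC (lt_trans z2).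
have Nr : 0 <= N%:R / N.+1%:R :> algC by rewrite divr_ge0.
have CH : horner_mx M (\prod_(z <- s) ('X - z%:P)) * 1 = 0.
  by rewrite -sE Cayley_Hamilton mul0r.
have [C C0 CP] := decay_of_annihilator NP Nr CH.
have := archi_boundP C0; set c := Num.bound _ => Cc.
exists c, N => k i j.
rewrite -(ler_rat algC) ratr_norm; apply: (le_trans _ (_ : C * (N%:R / N.+1%:R) ^+ k <= _)).
  by have := CP k i j; rewrite mulr1 /M -rmorphXn /= mxE.
rewrite rmorphM /= rmorphXn /= fmorph_div /= !ratr_nat ler_wpM2r ?exprn_ge0 //.
exact: ltW.
Qed.

End Decay.

(** * Common denominators *)

Section Discreteness.
Variable n : nat.
Implicit Types (M : 'M[rat]_n.+1) (x y : 'cV[rat]_n.+1).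

Definition adjoin_upto M k : set 'cV[rat]_n.+1 :=
  [set x | exists c : nat -> 'cV[int]_n.+1, x = \sum_(i < k) M ^+ i *m zvec (c i)].

Lemma zvecD (c d : 'cV[int]_n.+1) : zvec (c + d) = zvec c + zvec d.
Proof. by rewrite /zvec map_mxD. Qed.

Lemma adjoin_upto_le M k l x : (k <= l)%N -> adjoin_upto M k x -> adjoin_upto M l x.
Proof.
by move=> kl [c ->]; rewrite (adjoin_le _ _ kl); exists (fun i => if (i < k)%N then c i else 0).
Qed.

Lemma adjoin_uptoD M k x y : adjoin_upto M k x -> adjoin_upto M k y ->
  adjoin_upto M k (x + y).
Proof.
move=> [c ->] [d ->]; exists (fun i => c i + d i).
by rewrite -big_split; apply: eq_bigr => i _; rewrite zvecD mulmxDr.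
Qed.

Lemma adjoin_upto_adjoin M k x : adjoin_upto M k x -> adjoin M x.
Proof.
by move=> /(adjoin_upto_le (leqnSn k)) [c ->]; exists k.+1 => //; exists c.
Qed.

Lemma adjoin_upto_zvec M k c : (0 < k)%N -> adjoin_upto M k (zvec c).
Proof.
by move=> k0; apply: (adjoin_upto_le k0); exists (fun=> c); rewrite big_ord1 mul1mx.
Qed.

Lemma adjoin_upto_monom M k i c : (i < k)%N -> adjoin_upto M k (M ^+ i *m zvec c).
Proof.
move=> ik; exists (fun j => if j == i then c else 0).
rewrite (bigD1 (Ordinal ik)) //= eqxx big1 ?addr0 // => j ji.
by rewrite ifN ?zvec0 ?mulmx0 //; apply: contra ji => /eqP ji; apply/eqP/val_inj.
Qed.

Lemma common_denominator M :
  exists2 p : nat, (0 < p)%N & exists M' : 'M[int]_n.+1, p%:R *: M = map_mx intr M'.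
Proof.
pose p := (\prod_(ij : 'I_n.+1 * 'I_n.+1) `|denq (M ij.1 ij.2)|)%N.
exists p; first by apply: prodn_gt0 => ij; rewrite absz_gt0 denq_neq0.
pose q ij := (\prod_(ij' : 'I_n.+1 * 'I_n.+1 | ij' != ij) `|denq (M ij'.1 ij'.2)|)%N.
exists (\matrix_(i, j) (numq (M i j) * (q (i, j))%:Z)); apply/matrixP => i j.
rewrite !mxE /p (bigD1 (i, j)) //= natrM rmorphM /= numqE.
rewrite [M i j * _]mulrC mulrAC; congr (_ * _ * _).
by rewrite -[in RHS](gez0_abs (denq_ge0 _)).
Qed.

Lemma mulmx_zvec (M' : 'M[int]_n.+1) c :
  map_mx intr M' *m zvec c = zvec (M' *m c) :> 'cV[rat]_n.+1.
Proof. by rewrite /zvec map_mxM. Qed.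

Lemma scale_zvec (k : nat) (c : 'cV[int]_n.+1) :
  k%:R *: zvec c = zvec (k%:Z *: c) :> 'cV[rat]_n.+1.
Proof. by apply/matrixP => i j; rewrite !mxE rmorphM. Qed.

Variable A : 'M[rat]_n.+1.
Hypothesis Au : A \is a GRing.unit.
Local Notation B := A^-1.

Lemma inv_mulmx k x : B ^+ k *m (A ^+ k *m x) = x.
Proof.
rewrite mulmxA -[B ^+ k *m A ^+ k]/(_ * _) -exprMn_comm; last exact/commr_sym/commrV.
by rewrite mulVr // expr1n mul1mx.
Qed.

Lemma mulmx_inv k x : A ^+ k *m (B ^+ k *m x) = x.
Proof.
rewrite mulmxA -[A ^+ k *m B ^+ k]/(_ * _) -exprMn_comm; last exact: commrV.
by rewrite divrr // expr1n mul1mx.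
Qed.

(* [p Z^n] lies in [B Z^n], so membership in [B Z^n[B]] only depends on residues
   modulo [p], and finitely many powers of [B] suffice for all of them. *)
Lemma integral_adjoin_inv_bounded : exists2 k0 : nat, (0 < k0)%N &
  forall c y, adjoin B y -> zvec c = B *m y ->
    exists2 y', adjoin_upto B k0 y' & zvec c = B *m y'.
Proof.
have [p p0 [M' pA]] := common_denominator A.
pose P k c := exists2 y', adjoin_upto B k y' & zvec c = B *m y'.
pose res (c : 'cV[int]_n.+1) : {ffun 'I_n.+1 -> 'I_p.-1.+1} :=
  [ffun i => inord `|(c i ord0 %% p%:Z)%Z|%N].
have resP c d : res c = res d -> exists e : 'cV[int]_n.+1, c = d + p%:Z *: e.
  have pE : p.-1.+1 = p by rewrite prednK.
  have lt m : (`|(m %% p%:Z)%Z| < p.-1.+1)%N.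
    by rewrite pE -ltz_nat gez0_abs ?modz_ge0 ?ltz_pmod // eqz_nat -lt0n.
  move=> /ffunP cd; have pcd i : (p%:Z %| c i ord0 - d i ord0)%Z.
    have := congr1 val (cd i); rewrite !ffunE /= !inordK ?lt // => /(congr1 Posz).
    by rewrite !gez0_abs ?modz_ge0 ?eqz_nat -?lt0n // => E; rewrite -eqz_mod_dvd; apply/eqP.
  exists (\col_i ((c i ord0 - d i ord0) %/ p%:Z)%Z); apply/matrixP => i j.
  rewrite (ord1 j) 3!mxE; have := divzK (pcd i).
  by rewrite mulrC => ->; rewrite addrC subrK.
have /choice[K KP] : forall r, exists k, forall c y, res c = r -> adjoin B y ->
    zvec c = B *m y -> P k c.
  move=> r; have [[d [y [dr [k _ yk] dE]]]|none] := pselect (exists d y,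
      [/\ res d = r, adjoin B y & zvec d = B *m y]); last first.
    by exists 0%N => c y cr yB cE; exfalso; apply: none; exists c, y.
  exists k.+1 => c y' cr _ _.
  have [e ->] : exists e : 'cV[int]_n.+1, c = d + p%:Z *: e by apply: resP; rewrite cr dr.
  exists (y + zvec (M' *m e)).
    by apply: adjoin_uptoD; [exact: (adjoin_upto_le (leqnSn k))|exact: adjoin_upto_zvec].
  rewrite zvecD -scale_zvec mulmxDr dE -mulmx_zvec -pA -scalemxAl; congr (_ + _).
  by rewrite -[LHS](inv_mulmx 1) !expr1 -scalemxAr.
exists (\max_r K r).+1 => // c y yB cE.
have [y' y'K y'E] := KP (res c) c y erefl yB cE; exists y' => //.
by apply: adjoin_upto_le y'K; rewrite leqW // (leq_bigmax (res c)).
Qed.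

(** Descent on the degree. If [A^(k0+k) c] is the leading term of [x], multiplying [x] by
    [B^(k0+k-1)] shows that [c] lies in [B Z^n[B]]. Written with the exponents [1, ..., k0] of [B],
    [c] turns the leading term into a combination of [A^k, ..., A^(k0+k-1)], and the degree
    drops. *)
Lemma adjoin_cap_inv_upto : exists k0 : nat,
  forall x, adjoin A x -> adjoin B x -> adjoin_upto A k0 x.
Proof.
have [k0 k00 k0P] := integral_adjoin_inv_bounded; exists k0 => x [k _ xk] xB.
have {xk} : adjoin_upto A (k0 + k) x by apply: adjoin_upto_le xk; exact: leq_addl.
elim: k x xB => [|k IH] x xB [c xc]; first by exists c; rewrite addn0 in xc.
pose x' := \sum_(i < k0 + k) A ^+ i *m zvec (c i).
have xE : x = x' + A ^+ (k0 + k) *m zvec (c (k0 + k)%N).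
  by rewrite xc addnS big_ord_recr.
have BX m y : adjoin B y -> adjoin B (B ^+ m *m y).
  elim: m => [|m IHm] yB; first by rewrite mul1mx.
  by rewrite exprS -[_ * _]/(_ *m _) -mulmxA; apply/adjoin_mul/IHm.
have [y yB yE] : exists2 y, adjoin B y & zvec (c (k0 + k)%N) = B *m y.
  exists (B ^+ (k0 + k).-1 *m x - \sum_(i < k0 + k) B ^+ (k0 + k - i.+1) *m zvec (c i)).
    apply: adjoinB; first exact: BX.
    apply: (@adjoin_upto_adjoin _ (k0 + k)); exists (fun i => c (k0 + k - i.+1)%N).
    rewrite (reindex_inj rev_ord_inj) /=; apply: eq_bigr => i _; congr (_ ^+ _ *m zvec (c _)).
    by have := ltn_ord i; lia.
  have kS : (k0 + k)%N = (k0 + k).-1.+1 by rewrite prednK // addn_gt0 k00.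
  rewrite mulmxBr mulmxA -[B *m _]/(B * _) -exprS -kS.
  rewrite {1}xE mulmxDr inv_mulmx addrAC /x' !mulmx_sumr -sumrB big1 ?add0r // => i _.
  rewrite [B *m _]mulmxA -[B *m _]/(B * _) -exprS -subSn // subSS.
  rewrite -{1}(subnK (ltnW (ltn_ord i))) exprD -mulmxA inv_mulmx subrr //.
have [y' [e y'E] cE] := k0P _ _ yB yE.
apply: IH => //; rewrite xE; apply: adjoin_uptoD; first by exists c.
rewrite cE y'E mulmx_sumr mulmx_sumr.
apply: big_ind => [||i _]; first by exists (fun=> 0); rewrite big1 // => i _; rewrite zvec0 mulmx0.
  by move=> *; exact: adjoin_uptoD.
rewrite [B *m _]mulmxA -[B *m _]/(B * _) -exprS.
rewrite (_ : (k0 + k)%N = (k0 + k - i.+1) + i.+1)%N; last by have := ltn_ord i; lia.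
rewrite exprD -mulmxA mulmx_inv; apply: adjoin_upto_monom; have := ltn_ord i; lia.
Qed.

Lemma adjoin_upto_denominator k : exists2 N : nat, (0 < N)%N &
  forall x, adjoin_upto A k x -> exists c, N%:R *: x = zvec c.
Proof.
have [p p0 [M' pA]] := common_denominator A.
exists (p ^ k)%N; first by rewrite expn_gt0 p0.
elim: k => [|k IH] x [c ->]; first by exists 0; rewrite big_ord0 scaler0 zvec0.
rewrite big_ord_recr scalerDr /=.
have [d dE] : exists d, (p ^ k)%:R *: \sum_(i < k) A ^+ i *m zvec (c i) = zvec d.
  by apply: IH; exists c.
have [e eE] : exists e, (p ^ k)%:R *: (A ^+ k *m zvec (c k)) = zvec e.
  elim: (k) (c k) => [|m IHm] v; first by exists v; rewrite scale1r mul1mx.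
  have [e eE] := IHm (M' *m v); exists e; rewrite -eE -mulmx_zvec -pA.
  by rewrite expnSr natrM exprSr -[_ * A]/(_ *m A) -scalerA -scalemxAl -scalemxAr mulmxA.
exists (p%:Z *: d + p%:Z *: e).
by rewrite zvecD -!scale_zvec -dE -eE !scalerA -natrM -expnS.
Qed.

(** The arithmetic source of the discreteness of [Gamma]: a single [N] clears the denominators of
    every element of [Z^n[A]] that is integral at the [B]-adic place. *)
Lemma adjoin_cap_inv_denominator : exists2 N : nat, (0 < N)%N &
  forall x, adjoin A x -> adjoin B x -> exists c, N%:R *: x = zvec c.
Proof.
have [k kP] := adjoin_cap_inv_upto; have [N N0 NP] := adjoin_upto_denominator k.
by exists N => // x xA xB; apply/NP/kP.
Qed.

End Discreteness.

(** * The completion *)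

Section CompletionAction.
Variables (R : realType) (n : nat) (A : 'M[rat]_n.+1) (hA : expanding A).
Hypothesis hb : (2 <= residue_card A^-1)%N.
Local Notation laurent := (laurentG hA).
Local Notation nu := (@nu n A hA R).
Local Notation C := (completionB R hA hb).
Local Notation cauchyG := (cauchyG R hA hb).
Local Notation embed := (@embed R n A hA hb).
Local Notation B := (A^-1).
Local Notation repr_of := (@Defs.repr_of R n A hA hb).
Local Notation repr_ofK := (@Defs.repr_ofK R n A hA hb).
Local Notation mulA := (@Defs.mulA R n A hA hb).

Let Au : A \is a GRing.unit. Proof. exact: expanding_unit. Qed.
Let Bu : B \is a GRing.unit. Proof. by rewrite unitrV. Qed.

Fact laurent_mulV_subproof (y : laurent) : B *m y \in laurent_pred hA.
Proof. by apply/asboolP; have := laurent_mul Bu 1 (lvalP y); rewrite expr1z. Qed.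

Definition laurent_mulV (y : laurent) : laurent := LaurentG (laurent_mulV_subproof y).

Lemma laurent_mulAK : cancel (@laurent_mulA n A hA) laurent_mulV.
Proof.
by move=> y; apply: val_inj; rewrite /= mulmxA -[B *m A]/(B * A) mulVr // mul1mx.
Qed.

Lemma laurent_mulVK : cancel laurent_mulV (@laurent_mulA n A hA).
Proof.
by move=> y; apply: val_inj; rewrite /= mulmxA -[A *m B]/(A * B) divrr // mul1mx.
Qed.

Lemma nuV (y : laurent) : (nu y + 1%:E <= nu (laurent_mulV y))%E.
Proof.
apply: le_ereal_inf_tmp => _ [k nk <-]; rewrite -leeBrDr //.
have -> : (k%:~R%:E - 1%:E)%E = (k - 1)%:~R%:E :> \bar R by rewrite -EFinB intrB.
apply: ereal_inf_lbound; exists (k - 1) => //= yk; apply: nk.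
by have := filtr_mul Bu 1 yk; rewrite expr1z (_ : 1 + _ = k + 1) //; lia.
Qed.

Lemma nu_mulV (y : laurent) : nu (laurent_mulV y) = (nu y + 1%:E)%E.
Proof.
apply/eqP; rewrite eq_le nuV andbT.
by have := nuA R (laurent_mulV y); rewrite laurent_mulVK leeBlDr.
Qed.

Lemma laurent_mulVB (x y : laurent) :
  laurent_mulV x - laurent_mulV y = laurent_mulV (x - y).
Proof. by apply: val_inj; rewrite /= mulmxBr. Qed.

Lemma distB_mulV (x y : laurent) :
  distB R (laurent_mulV x) (laurent_mulV y) <= distB R x y.
Proof.
rewrite /distB laurent_mulVB; apply: (le_bpow hb); first exact: nu_gtNy.
by rewrite nu_mulV leeDl.
Qed.

Fact cauchy_mulV_subproof (u : cauchyG) :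
  (fun k => laurent_mulV (u k)) \in @cauchy_pred R n A hA hb.
Proof.
apply/asboolP => e e0; have [N uN] := cseqP u e0.
by exists N => i j Ni Nj; apply: le_lt_trans (distB_mulV _ _) _; exact: uN.
Qed.

Definition cauchy_mulV (u : cauchyG) : cauchyG := CauchyG (cauchy_mulV_subproof u).

Definition mulV (y : C) : C := class_of (cauchy_mulV (repr_of y)).

Lemma mulAB (x y : C) : mulA (x - y) = mulA x - mulA y.
Proof.
rewrite -[x]repr_ofK -[y]repr_ofK -class_ofB !mulA_class -class_ofB; congr class_of.
by apply/val_inj/funext => k; apply: val_inj; rewrite /= mulmxBr.
Qed.

Lemma mulVK : cancel mulV mulA.
Proof.
move=> y; rewrite /mulV mulA_class -[RHS]repr_ofK; congr class_of.
by apply/val_inj/funext => k; rewrite /= laurent_mulVK.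
Qed.

Lemma nuC_mulA (y : C) : nuC (mulA y) = (nuC y - 1%:E)%E.
Proof.
rewrite /Defs.mulA nuC_class /nuC.
have nuE k : nu (laurent_mulA (repr_of y k)) = (nu (repr_of y k) - 1%:E)%E.
  by rewrite -[in RHS](laurent_mulAK (repr_of y k)) nu_mulV addeK.
have [/(null_nu_cvg hb) u0|[r ur]] := nu_cauchy (repr_of y).
  rewrite (cvg_lim _ u0) //=; apply: cvg_lim => //.
  apply/cvgeyPgt => r; move/cvgeyPgt : u0 => /(_ (r + 1)); apply: filterS => k /= rk.
  by rewrite nuE lteBrDr // -EFinD.
rewrite (cvg_lim _ (cvg_near_cst _ ur)) //; apply: cvg_lim => //.
by apply: cvg_near_cst; apply: filterS ur => k /= uk; rewrite nuE uk.
Qed.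

Lemma mulA_inj : injective mulA.
Proof.
move=> x y /eqP; rewrite -subr_eq0 -mulAB => /eqP xy.
apply/eqP; rewrite -subr_eq0; apply/eqP; apply: nuC_eqy.
have := nuC_mulA (x - y); rewrite xy nuC0; have := nuC_gtNy (x - y).
by case: nuC.
Qed.

Lemma mulAK : cancel mulA mulV.
Proof. by move=> y; apply: mulA_inj; rewrite mulVK. Qed.

Lemma nuC_mulV (y : C) : nuC (mulV y) = (nuC y + 1%:E)%E.
Proof. by rewrite -{2}[y]mulVK nuC_mulA subeK. Qed.

Lemma embedB (x y : laurent) : embed (x - y) = embed x - embed y.
Proof. by rewrite /embed -class_ofB; congr class_of; exact: val_inj. Qed.

(** The ultrametric makes these balls open subgroups, and by [nbhsC] they form a base of
    neighbourhoods of [0]. Topological arguments on the completion thus use integer levels, which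
    [A] and [A^-1] shift by exactly one, in place of radii. *)
Definition levelC (j : int) : set C := [set y | ((j%:~R)%:E <= nuC y)%E].

Lemma levelCN j y : levelC j y -> levelC j (- y).
Proof. by rewrite /levelC /= nuCN. Qed.

Lemma levelCD j x y : levelC j x -> levelC j y -> levelC j (x + y).
Proof.
rewrite /levelC /= => xj yj; apply: le_trans (le_nuCD x y).
by rewrite le_min xj yj.
Qed.

Lemma levelCB j x y : levelC j x -> levelC j y -> levelC j (x - y).
Proof. by move=> xj /levelCN; exact: levelCD. Qed.

Lemma levelC_le i j : i <= j -> levelC j `<=` levelC i.
Proof. by move=> ij y /=; apply: le_trans; rewrite lee_fin ler_int. Qed.

Lemma levelC_mulV j y : levelC j y -> levelC (j + 1) (mulV y).
Proof. by rewrite /levelC /= nuC_mulV intrD EFinD => ?; exact: leeD2r. Qed.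

Lemma levelC_mulA j y : levelC j y -> levelC (j - 1) (mulA y).
Proof. by rewrite /levelC /= nuC_mulA intrB EFinB => ?; exact: leeD2r. Qed.

Lemma nbhsC (y : C) (U : set C) :
  nbhs y U <-> exists j : nat, forall z, levelC j (z - y) -> U z.
Proof.
have b1 : 1 < (residue_card B)%:R :> R by rewrite ltr1n.
have b0 : 0 < (residue_card B)%:R :> R by rewrite (lt_trans ltr01).
split=> [/nbhs_ballP[e /= e0 yU]|[j jU]].
  have : (residue_card B)%:R^-1 ^+ k @[k --> \oo] --> (0 : R).
    by apply: (@cvg_expr R); rewrite ger0_norm ?invr_ge0 ?ler0n // invf_lt1.
  move/cvgr0_norm_lt => /(_ _ e0)[j _ /(_ j (leqnn _))] /= je.
  exists j => z jz; apply: yU; rewrite ballEmdist; change (distC y z < e); rewrite distC_sym.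
  apply: le_lt_trans je; rewrite ger0_norm ?exprn_ge0 ?invr_ge0 ?ler0n //.
  apply: (le_trans (le_bpow hb _ jz)); first exact: ltNyr.
  by rewrite /= powRN powR_mulrn ?ler0n // exprVn.
apply/nbhs_ballP; exists (bpow A (j%:R)%:E : R) => /=; first exact: (bpow_gt0 hb).
move=> z; rewrite ballEmdist; change (distC y z < bpow A (j%:R)%:E -> U z).
rewrite distC_sym => /(lt_bpow hb) jz.
by apply: jU; rewrite /levelC /=; apply/ltW/jz; exact: nuC_gtNy.
Qed.

Lemma levelC_open j : open (levelC j).
Proof.
rewrite openE => y yj; apply/nbhsC; exists `|j|%N => z zj.
rewrite -[z](subrK y); apply: levelCD => //; apply: levelC_le zj.
by rewrite abszE ler_norm.
Qed.

Lemma completionB_add_continuous : continuous (fun z : C * C => z.1 + z.2).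
Proof.
move=> [x y] U /nbhsC[j jU].
exists ([set x' | levelC j (x' - x)], [set y' | levelC j (y' - y)]) => /=.
  by split; apply/nbhsC; exists j.
move=> [x' y'] /= [x'j y'j]; apply: jU => /=.
by rewrite opprD addrACA; exact: levelCD.
Qed.

Lemma mulA_continuous : continuous mulA.
Proof.
move=> x U /nbhsC[j jU]; apply/nbhsC; exists j.+1 => z zj; apply: jU.
by rewrite -mulAB; have := levelC_mulA zj; rewrite -addn1 PoszD addrK.
Qed.

Lemma mulV_continuous : continuous mulV.
Proof.
move=> x U /nbhsC[j jU]; apply/nbhsC; exists j => z zj; apply: jU.
rewrite -{1}[z]mulVK -{1}[x]mulVK -mulAB in zj.
have := levelC_mulV zj; rewrite mulAK.
by apply: levelC_le; rewrite lerDl.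
Qed.

Lemma embed_dense (y : C) (j : nat) : exists l, levelC j (y - embed l).
Proof.
pose u := repr_of y; have b0 : 0 < bpow A (j%:R)%:E :> R by exact: (bpow_gt0 hb).
have [N uN] := cseqP u b0.
exists (u N); rewrite -[y]repr_ofK /embed -class_ofB /levelC /= nuC_class.
apply: lime_ge.
  exact: nu_cauchy_cvg.
near=> k.
have : distB R (u k) (u N) < bpow A (j%:R)%:E by apply: uN => //; near: k; exact: nbhs_infty_ge.
by move/(lt_bpow hb (nu_gtNy _ _))/ltW.
Unshelve. all: by end_near. Qed.

Lemma laurentG_countable : countable [set: laurent].
Proof.
apply/countable_injP; exists (fun y : laurent => choice.pickle (lval y)) => x y _ _.
by move=> /(pcan_inj choice.pickleK)/val_inj.
Qed.

Lemma completionB_second_countable : @second_countable C.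
Proof.
apply: (@second_countable_dense R C (range embed)).
  exact: sub_countable (card_image_le _ _) laurentG_countable.
move=> y e e0; have /nbhsC[j jU] : nbhs y (ball y e) by exact: nbhsx_ballx.
have [l yl] := embed_dense y j; exists (embed l) => //.
by apply: jU; rewrite -opprB; exact: levelCN.
Qed.

End CompletionAction.

(** * The representation space *)

Section RepresentationSpace.
Variables (R : realType) (n : nat) (A : 'M[rat]_n.+1) (hA : expanding A).
Hypothesis hb : (2 <= residue_card A^-1)%N.
Local Notation laurent := (laurentG hA).
Local Notation C := (completionB R hA hb).
Local Notation K := (KA R hA hb).
Local Notation V := 'cV[R]_n.+1.
Local Notation embed := (@embed R n A hA hb).
Local Notation mulA := (@Defs.mulA R n A hA hb).
Local Notation phi := (phi R hA hb).
Local Notation actA := (@actA R n A hA hb).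
Implicit Types (x y z : K) (F S U : set K).

Definition small (v : V) (e : R) := forall i, `|v i ord0| < e.

Lemma nbhs_small (v : V) (U : set V) :
  nbhs v U <-> exists2 e : R, 0 < e & forall w, small (w - v) e -> U w.
Proof.
apply: (iff_trans (nbhs_ballP v U)); split=> [[e /= e0 vU]|[e e0 eU]].
  exists e => // w wv; apply: vU; split=> // i j; rewrite (ord1 j) /ball /= distrC.
  by have := wv i; rewrite !mxE.
exists e => //= w [_ vw]; apply: eU => i.
by have := vw i ord0; rewrite /ball /= distrC !mxE.
Qed.

Lemma nbhsK z U : nbhs z U <-> exists (e : R) (j : nat), 0 < e /\
  forall z', small (z'.1 - z.1) e -> levelC j (z'.2 - z.2) -> U z'.
Proof.
case: z => v w; split=> [[[P Q] /= [/nbhs_small[e e0 eP] /nbhsC[j jQ]] PQU]|].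
  by exists e, j; split=> // z' ? ?; apply: PQU; split; [exact: eP|exact: jQ].
move=> [e [j [e0 ejU]]] /=.
exists ([set v' | small (v' - v) e], [set w' | levelC j (w' - w)]) => /=.
  by split; [apply/nbhs_small; exists e|apply/nbhsC; exists j].
by move=> -[v' w'] /= [? ?]; exact: ejU.
Qed.

Lemma smallN v e : small v e -> small (- v) e.
Proof. by move=> ve i; rewrite mxE normrN. Qed.

Lemma smallD v w d e : small v d -> small w e -> small (v + w) (d + e).
Proof. by move=> vd we i; rewrite mxE (le_lt_trans (ler_normD _ _)) // ltrD. Qed.

Lemma small_mulmx (M : 'M[R]_n.+1) v (s e : R) : (forall i j, `|M i j| <= s) ->
  small v e -> forall i, `|(M *m v) i ord0| <= n.+1%:R * (s * e).
Proof.
move=> Ms ve i; rewrite mxE (le_trans (ler_norm_sum _ _ _)) //.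
rewrite -[X in X%:R]card_ord mulr_natl -sumr_const; apply: ler_sum => j _.
by rewrite normrM ler_pM // ltW.
Qed.

Lemma mulmx_continuousV (M : 'M[R]_n.+1) : continuous (fun v : V => M *m v).
Proof.
move=> v U /nbhs_small[e e0 eU]; apply/nbhs_small.
pose s : R := 1 + \sum_i \sum_j `|M i j|.
have s0 : 0 < s by rewrite ltr_pwDl // sumr_ge0 // => i _; rewrite sumr_ge0.
have Ms i j : `|M i j| <= s.
  apply: ler_wpDl => //; rewrite (bigD1 i) //= (bigD1 j) //= -addrA lerDl addr_ge0 ?sumr_ge0 //.
  by move=> k _; apply: sumr_ge0.
exists (e / (2 * n.+1%:R * s)); first by rewrite divr_gt0 // !mulr_gt0.
move=> w wv; apply: eU => i; rewrite -mulmxBr.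
apply: (le_lt_trans (small_mulmx Ms wv i)).
have N0 : 0 < n.+1%:R :> R by [].
move: (n.+1%:R : R) N0 => N N0; rewrite (_ : _ * _ = e / 2); first by lra.
by field; rewrite !gt_eqF.
Qed.

Definition actV (z : K) : K := (map_mx ratr A^-1 *m z.1, mulV z.2).

Let Au : A \is a GRing.unit. Proof. exact: expanding_unit. Qed.

Lemma actAK : cancel actA actV.
Proof.
move=> [v w]; rewrite /Defs.actA /actV /= mulAK mulmxA -map_mxM.
by rewrite -[_ *m A]/(_ * _) mulVr // map_mx1 mul1mx.
Qed.

Lemma actVK : cancel actV actA.
Proof.
move=> [v w]; rewrite /Defs.actA /actV /= mulVK mulmxA -map_mxM.
by rewrite -[_ *m A^-1]/(_ * _) divrr // map_mx1 mul1mx.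
Qed.

Lemma actAB x y : actA (x - y) = actA x - actA y.
Proof. by apply/pair_equal_spec; split; rewrite /= ?mulmxBr ?mulAB. Qed.

Lemma actA0 : actA 0 = 0.
Proof. by rewrite -[0 in LHS](subrr (0 : K)) actAB subrr. Qed.

Lemma actAD x y : actA (x + y) = actA x + actA y.
Proof. by rewrite -[y in LHS]opprK actAB -[- y]sub0r actAB actA0 sub0r opprK. Qed.

Lemma iter_actAD k x y : iter k actA (x + y) = iter k actA x + iter k actA y.
Proof. by elim: k => //= k ->; rewrite actAD. Qed.

Lemma iter_actAK k : cancel (iter k actA) (iter k actV).
Proof. by elim: k => // k IH z; rewrite iterSr [iter _ actA z]iterS actAK IH. Qed.

Lemma iter_actVK k : cancel (iter k actV) (iter k actA).
Proof. by elim: k => // k IH z; rewrite iterSr [iter _ actV z]iterS actVK IH. Qed.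

Lemma iter_actVB k x y : iter k actV (x - y) = iter k actV x - iter k actV y.
Proof.
apply: (can_inj (iter_actAK k)); rewrite iter_actVK.
have -> (u v : K) : iter k actA (u - v) = iter k actA u - iter k actA v.
  by elim: k => //= k ->; rewrite actAB.
by rewrite !iter_actVK.
Qed.

Lemma phiB (g h : laurent) : phi (g - h) = phi g - phi h.
Proof. by rewrite /Defs.phi embedB /= map_mxB. Qed.

Lemma phi0 : phi 0 = 0.
Proof. by rewrite -[0 in LHS](subrr (0 : laurent)) phiB subrr. Qed.

Lemma phiD (g h : laurent) : phi (g + h) = phi g + phi h.
Proof. by rewrite -[h in LHS]opprK phiB -[- h]sub0r phiB phi0 sub0r opprK. Qed.

Lemma phi_inj : injective phi.
Proof.
move=> g h [/matrixP gh _]; apply/val_inj/matrixP => i j.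
by have := gh i j; rewrite !mxE => /fmorph_inj.
Qed.

Lemma actA_phi (g : laurent) : actA (phi g) = phi (laurent_mulA g).
Proof. by rewrite /Defs.actA /Defs.phi /= mulA_embed map_mxM. Qed.

Lemma actA_continuous : continuous actA.
Proof.
move=> [v w] U [[P Q] /= [vP wQ] PQU].
exists (mulmx (map_mx ratr A) @^-1` P, mulA @^-1` Q) => /=.
  by split; [exact: mulmx_continuousV|exact: mulA_continuous].
by move=> [v' w'] /= [? ?]; apply: PQU.
Qed.

Lemma actV_continuous : continuous actV.
Proof.
move=> [v w] U [[P Q] /= [vP wQ] PQU].
exists (mulmx (map_mx ratr A^-1) @^-1` P, @mulV R n A hA hb @^-1` Q) => /=.
  by split; [exact: mulmx_continuousV|exact: mulV_continuous].
by move=> [v' w'] /= [? ?]; apply: PQU.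
Qed.

Lemma shiftK_continuous (t : K) : continuous (fun z : K => z - t).
Proof.
move=> z U /nbhsK[e [j [e0 ejU]]]; apply/nbhsK; exists e, j; split=> // z' z1 z2.
by apply: ejU; rewrite /= opprB addrA subrK.
Qed.

Lemma KA_hausdorff : hausdorff_space K.
Proof.
move=> [v w] [v' w'] zz'; congr pair.
  apply: (@norm_hausdorff R V) => P Q vP v'Q.
  have [] := zz' (fst @^-1` P) (fst @^-1` Q).
  - exact: (@cvg_fst _ _ (nbhs v) (nbhs w)).
  - exact: (@cvg_fst _ _ (nbhs v') (nbhs w')).
  by move=> z [? ?]; exists z.1.
apply: (@metric_hausdorff R C) => P Q vP v'Q.
have [] := zz' (snd @^-1` P) (snd @^-1` Q).
- exact: (@cvg_snd _ _ (nbhs v) (nbhs w)).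
- exact: (@cvg_snd _ _ (nbhs v') (nbhs w')).
by move=> z [? ?]; exists z.2.
Qed.

(** Every point has a neighbourhood on which one bound [N], and then every larger one, holds;
    compactness makes [N] uniform. *)
Lemma compact_boundedK F : compact F -> exists N : nat,
  forall z, F z -> small z.1 N%:R /\ levelC (- N%:Z) z.2.
Proof.
move=> /compact_near_coveringP cF.
have := cF nat \oo (fun N z => small z.1 N%:R /\ levelC (- N%:Z) z.2) _.
case=> [z Fz|N _ NP]; last by exists N; exact: NP (leqnn N).
have [m zm] : exists m : nat, small z.1 m%:R.
  pose s : R := \sum_i `|z.1 i ord0|; exists (Num.bound s) => i.
  have s0 : 0 <= s by rewrite sumr_ge0.
  by apply: le_lt_trans (archi_boundP s0); rewrite /s (bigD1 i) //= lerDl sumr_ge0.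
have [l zl] : exists l : nat, levelC (- l%:Z) z.2.
  rewrite /levelC /=; have := nuC_gtNy z.2; case: (nuC z.2) => [r _| _|//]; last first.
    by exists 0%N; rewrite leey.
  exists (Num.bound `|r|); rewrite lee_fin mulrNz lerNl.
  by rewrite (le_trans (ler_norm _)) // normrN -normr_id ltW // archi_boundP.
exists ([set z' : K | small (z'.1 - z.1) 1 /\ levelC 0 (z'.2 - z.2)],
        [set N : nat | (m + l + 1 <= N)%N]) => /=.
  split; last by exists (m + l + 1)%N.
  by apply/nbhsK; exists 1, 0%N.
move=> [z' N] /= [[z'1 z'2] mlN]; split.
  have := smallD z'1 zm; rewrite subrK => z'm i; apply: (lt_le_trans (z'm i)).
  by rewrite -[1]/(1%:R) -natrD ler_nat; lia.
rewrite -[z'.2](subrK z.2); apply: levelCD; first by apply: levelC_le z'2; lia.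
by apply: levelC_le zl; lia.
Qed.

Lemma compact_closedK F : compact F -> closed F.
Proof. by apply: compact_closed; exact: KA_hausdorff. Qed.

Lemma iter_actVE k z : iter k actV z =
  (map_mx ratr (A^-1 ^+ k) *m z.1, iter k (@mulV R n A hA hb) z.2).
Proof.
elim: k => [|k IH]; first by rewrite /= map_mx1 mul1mx; case: z.
by rewrite iterS IH /actV /= mulmxA -map_mxM -[A^-1 *m _]/(A^-1 * _) exprS.
Qed.

(** In the real factor this is the geometric decay of the entries of [A^-k]. In the other factor
    each step raises the level by one, so [j + N] steps lead from level [- N] to level [j]. *)
Lemma actV_contracts (N : nat) (e : R) (j : nat) : 0 < e ->
  exists k0 : nat, forall k z, (k0 <= k)%N -> small z.1 N%:R -> levelC (- N%:Z) z.2 ->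
    small (iter k actV z).1 e /\ levelC j (iter k actV z).2.
Proof.
move=> e0; have [c [m decay]] := expanding_decay hA.
pose r : R := m%:R / m.+1%:R.
have r0 : 0 <= r by rewrite divr_ge0.
have r1 : `|r| < 1 by rewrite ger0_norm // ltr_pdivrMr ?ltr0n // mul1r ltr_nat.
have : n.+1%:R * (c%:R * r ^+ k * N%:R) @[k --> \oo] --> (0 : R).
  rewrite -(mulr0 (n.+1%:R * (c%:R * N%:R))).
  under eq_fun do rewrite [c%:R * _ * _]mulrAC mulrA.
  by apply: cvgM; [exact: cvg_cst|exact: (@cvg_expr R)].
move/cvgr0_norm_lt => /(_ _ e0)[k1 _ k1P].
exists (maxn k1 (j + N)) => k z; rewrite geq_max => /andP[k1k jk] zN zl.
rewrite iter_actVE; split=> [i|] /=.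
  apply: (le_lt_trans _ (k1P k k1k)); apply: le_trans (ler_norm _).
  apply: small_mulmx zN i => i' j'; rewrite mxE -ratr_norm.
  apply: (le_trans (_ : _ <= ratr (c%:R * (m%:R / m.+1%:R) ^+ k))); first by rewrite ler_rat.
  by rewrite rmorphM rmorphXn /= fmorph_div /= !ratr_nat.
have : levelC (k%:Z - N%:Z) (iter k (@mulV R n A hA hb) z.2).
  elim: k {k1k jk} => [|k IH]; first by rewrite sub0r.
  by rewrite iterS; apply: levelC_le (levelC_mulV IH); lia.
by apply: levelC_le; lia.
Qed.

End RepresentationSpace.

(** * Lebesgue and Haar measures *)

Section LebesgueInvariance.
Variables (R : realType) (n : nat).
Local Notation V := 'cV[R]_n.+1.

Definition box (a b : V) : set V := [set x : V | forall i, a i ord0 <= x i ord0 <= b i ord0].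

Lemma box_closed (a b : V) : closed (box a b).
Proof.
rewrite (_ : box a b = \bigcap_(i in [set: 'I_n.+1])
    ((fun x : V => x i ord0) @^-1` `[a i ord0, b i ord0])).
  apply: closed_bigI => i _; apply: closed_comp => [x _|]; last exact: interval_closed.
  exact: coord_continuous.
apply/seteqP; split=> x xab i; have := xab i; rewrite /= in_itv /=.
  by move=> + _.
by move=> /(_ Logic.I).
Qed.

Lemma rat_small (v : V) (e : R) : 0 < e ->
  exists q : 'cV[rat]_n.+1, small (v - map_mx ratr q) e.
Proof.
move=> e0; have /choice[q qP] : forall i, exists q : rat, `|v i ord0 - ratr q| < e.
  move=> i; have [|q] := @rat_in_itvoo R (v i ord0 - e) (v i ord0 + e).
    by rewrite ltrBlDr -addrA ltrDl addr_gt0.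
  by rewrite in_itv /= => vq; exists q; rewrite distrC ltr_distl.
by exists (\col_i q i) => i; rewrite !mxE.
Qed.

Lemma cV_second_countable : @second_countable V.
Proof.
apply: (@second_countable_dense R V (range (map_mx ratr : 'cV[rat]_n.+1 -> V))).
  exact: sub_countable (card_image_le _ _) (countableP _).
move=> v e e0; have /nbhs_small[d d0 dU] : nbhs v (ball v e) by exact: nbhsx_ballx.
have [q vq] := rat_small v d0; exists (map_mx ratr q) => //.
by apply: dU; rewrite -opprB; exact: smallN.
Qed.

Lemma borel_boxes : @measurable _ (borel V) = <<s [set box ab.1 ab.2 | ab in [set: V * V]] >>.
Proof.
set G := [set box ab.1 ab.2 | ab in _].
apply/seteqP; split; apply: smallest_sub; try exact: smallest_sigma_algebra; last first.
  move=> _ [[a b] _ <-]; exact: (@closed_borel V _ (@box_closed a b)).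
move=> U; rewrite openE => oU; pose r k : R := k.+1%:R^-1.
(* A box with rational centre and half-side [1/(k+1) < e/2] that contains [x] stays within distance
   [e] of [x] in each coordinate; there are countably many such boxes. *)
pose c (qk : 'cV[rat]_n.+1 * nat) : set V :=
  box (map_mx ratr qk.1 - const_mx (r qk.2)) (map_mx ratr qk.1 + const_mx (r qk.2)).
have -> : U = \bigcup_(qk in [set qk | c qk `<=` U]) c qk.
  apply/seteqP; split=> [x /oU/nbhs_small[e e0 eU]|x [qk /= cU xqk]]; last exact: cU.
  have e20 : 0 < e / 2 by rewrite divr_gt0.
  have [k] := ltr_add_invr e20; rewrite add0r => ke.
  have rk0 : 0 < r k by rewrite /r invr_gt0.
  have [q xq] := rat_small x rk0.
  have xcq : c (q, k) x.
    move=> i; have := xq i; rewrite !mxE /= ltr_distl => /andP[q1 q2].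
    by rewrite (ltW q1) (ltW q2).
  exists (q, k) => //= y ycq; apply: eU => i.
  have := xq i; have := ycq i; rewrite !mxE /= ltr_distl => /andP[? ?] /andP[? ?].
  by rewrite ltr_distl -/(r k) in ke *; apply/andP; split; lra.
apply: (@countable_bigcup_measurable _ (g_sigma_algebraType G)).
  by apply: countableP.
move=> qk _; apply: sub_sigma_algebra.
by exists (map_mx ratr qk.1 - const_mx (r qk.2), map_mx ratr qk.1 + const_mx (r qk.2)).
Qed.

Variable lambda : {measure set (borel V) -> \bar R}.
Hypothesis hlambda : is_lebesgue lambda.

Lemma lebesgue_box_fin (a b : V) : (lambda (box a b) < +oo)%E.
Proof.
have [ab|/existsNP[i abi]] := pselect (forall i, a i ord0 <= b i ord0).
  by rewrite hlambda // ltry.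
rewrite (_ : box a b = set0) ?measure0 ?ltry // -subset0 => x /(_ i)/andP[ax xb].
by apply: abi; exact: le_trans ax xb.
Qed.

Lemma bigcup_box : \bigcup_k box (const_mx (- k%:R)) (const_mx k%:R) = [set: V].
Proof.
apply/seteqP; split=> // x _; pose s : R := \sum_i `|x i ord0|.
have s0 : 0 <= s by rewrite sumr_ge0.
exists (Num.bound s) => // i; rewrite !mxE -ler_norml.
apply: (le_trans _ (ltW (archi_boundP s0))).
by rewrite /s (bigD1 i) //= lerDl sumr_ge0.
Qed.

Lemma lebesgue_sigma_finite : sigma_finite setT lambda.
Proof.
exists (fun k => box (const_mx (- k%:R)) (const_mx k%:R)); first by rewrite bigcup_box.
by move=> k; split; [exact: (@closed_borel V _ (@box_closed _ _))|exact: lebesgue_box_fin].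
Qed.

Lemma shift_continuousV (t : V) : continuous (fun x : V => t + x).
Proof.
move=> x U /nbhs_small[e e0 eU]; apply/nbhs_small; exists e => // w wx; apply: eU.
by rewrite opprD addrACA subrr add0r.
Qed.

(** [is_lebesgue] prescribes the measure of closed boxes only. These are stable under intersection,
    generate the Borel sets and are permuted by translations with their side lengths kept, so the
    uniqueness theorem for measures applies. *)
Lemma lebesgue_invariant (t : V) (E : set (borel V)) : measurable E ->
  lambda ((fun x : V => t + x) @^-1` E) = lambda E.
Proof.
move=> mE; pose f : borel V -> borel V := fun x : V => t + x.
have mf : measurable_fun setT f := continuous_borel (@shift_continuousV t).
pose m2 : measure _ _ := pushforward lambda f.
apply/esym; rewrite -[RHS]/(m2 mf E).
apply: (@measure_unique _ R (borel V) [set box ab.1 ab.2 | ab in [set: V * V]]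
  (fun k => box (const_mx (- k%:R)) (const_mx k%:R)) _ _ _ _ lambda (m2 mf)) => //.
- exact: borel_boxes.
- move=> _ _ [[a b] _ <-] [[a' b'] _ <-] /=.
  exists (\col_i Num.max (a i ord0) (a' i ord0), \col_i Num.min (b i ord0) (b' i ord0)) => //.
  apply/seteqP; split=> x /= => [xab|[xab xab']]; last first.
    move=> i; have /andP[a1 b1] := xab i; have /andP[a2 b2] := xab' i.
    by rewrite !mxE ge_max le_min a1 a2 b1 b2.
  split=> i; have := xab i; rewrite !mxE ge_max le_min.
    by move=> /andP[/andP[? ?] /andP[? ?]]; apply/andP.
  by move=> /andP[/andP[? ?] /andP[? ?]]; apply/andP.
- by move=> k; exists (const_mx (- k%:R), const_mx k%:R).
- exact: bigcup_box.
- move=> _ [[a b] _ <-]; rewrite /m2 /= /pushforward.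
  have -> : f @^-1` box a b = box (a - t) (b - t).
    apply/seteqP; split=> x xab i; have := xab i; rewrite /f /= !mxE.
      by rewrite lerBlDl lerBrDl.
    by rewrite lerBlDl lerBrDl.
  have [ab|/existsNP[i abi]] := pselect (forall i, a i ord0 <= b i ord0).
    rewrite !hlambda => // [|i]; last by rewrite !mxE lerD2r.
    by congr (_%:E); apply: eq_bigr => i _; rewrite !mxE opprB addrA subrK.
  have b0 (u v : V) : ~ u i ord0 <= v i ord0 -> box u v = set0.
    by move=> uv; rewrite -subset0 => x /(_ i)/andP[ux xv]; apply: uv; exact: le_trans ux xv.
  by rewrite !b0 // !mxE lerD2r.
- by move=> k; exact: lebesgue_box_fin.
Qed.

End LebesgueInvariance.

(** * Haar measure on the completion *)

Section HaarProduct.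
Variables (R : realType) (n : nat) (A : 'M[rat]_n.+1) (hA : expanding A).
Hypothesis hb : (2 <= residue_card A^-1)%N.
Local Notation C := (completionB R hA hb).
Local Notation V := 'cV[R]_n.+1.
Variable muB : {measure set (borel C) -> \bar R}.
Hypotheses (hmuB : haar muB) (hmuB1 : muB (integersB R hA hb) = 1%E).

Lemma haar_invariant (t : C) (E : set (borel C)) : measurable E ->
  muB ((fun y : C => t + y) @^-1` E) = muB E.
Proof.
move=> mE; have [_ inv _] := hmuB; rewrite -(inv (- t) E mE); congr (muB _).
apply/seteqP; split=> y /= => [Ey|[z Ez <-]]; last by rewrite addrC subrK.
by exists (t + y) => //; rewrite addrC addKr.
Qed.

Lemma shift_continuousC (t : C) : continuous (fun y : C => t + y).
Proof.
move=> y U /nbhsC[j jU]; apply/nbhsC; exists j => z zy; apply: jU.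
by rewrite opprD addrACA subrr add0r.
Qed.

Lemma integersB_level : integersB R hA hb = levelC 0.
Proof. by []. Qed.

Lemma laurentG_enum : exists l : nat -> laurentG hA, forall g, exists k, l k = g.
Proof.
have [|l lT] := countable_range (laurentG_countable hA); first by exists 0.
exists l => g; have : [set: laurentG hA] g by [].
by rewrite lT => -[k _ <-]; exists k.
Qed.

(** The image of the countable group [Z^n(B)] is dense, so its translates of [Z^n[[B]]], all of
    measure 1, cover the completion. *)
Lemma haar_sigma_finite : sigma_finite setT muB.
Proof.
have [l lP] := laurentG_enum.
exists (fun k => (fun y : C => - embed R hb (l k) + y) @^-1` levelC 0).
  apply/seteqP; split=> // y _; have [g yg] := embed_dense y 0.
  by have [k kg] := lP g; exists k => //=; rewrite kg addrC.
move=> k; have mL : measurable (levelC 0 : set (borel C)).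
  exact: (@open_borel C _ (@levelC_open _ _ _ _ _ _)).
split; last by rewrite haar_invariant // -integersB_level hmuB1 ltry.
apply: (@open_borel C); apply: open_comp => [y _|]; last exact: levelC_open.
exact: shift_continuousC.
Qed.

End HaarProduct.

(** * The product measure *)

Lemma measure_countable_null d (T : measurableType d) (R : realType)
  (mu : {measure set T -> \bar R}) I (D : set I) (F : I -> set T) :
  countable D -> (forall i, D i -> measurable (F i)) -> (forall i, D i -> mu (F i) = 0%E) ->
  mu (\bigcup_(i in D) F i) = 0%E.
Proof.
move=> cD mF F0; have [->|D0] := eqVneq D set0; first by rewrite bigcup_set0 measure0.
have [|f Df] := @countable_range _ D cD; first by apply/set0P.
have Dk k : D (f k) by rewrite Df; exists k.
rewrite Df bigcup_image; apply/eqP; rewrite eq_le measure_ge0 andbT.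
have mFf k : measurable (F (f k)) by exact: mF.
have := measure_sigma_subadditive mu mFf (bigcupT_measurable _ mFf) (@subset_refl _ _).
by rewrite eseries0 // => k _ _; rewrite /= F0.
Qed.

Section ProductMeasure.
Variables (R : realType) (n : nat) (A : 'M[rat]_n.+1) (hA : expanding A).
Hypothesis hb : (2 <= residue_card A^-1)%N.
Local Notation C := (completionB R hA hb).
Local Notation V := 'cV[R]_n.+1.
Local Notation K := (KA R hA hb).
Local Notation T := (borel V * borel C)%type.
Local Notation actA := (@actA R n A hA hb).

Lemma open_measurableK (U : set K) : open U -> measurable (U : set T).
Proof.
apply: (@open_prod_measurable V C); first exact: cV_second_countable.
exact: completionB_second_countable.
Qed.

Lemma closed_measurableK (F : set K) : closed F -> measurable (F : set T).
Proof.
by move=> cF; rewrite -[F]setCK; apply: measurableC; apply: open_measurableK; exact: closed_openC.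
Qed.

Lemma continuous_measurableK (f : K -> K) (X : set K) : continuous f ->
  measurable (X : set T) -> measurable (f @^-1` X : set T).
Proof.
move=> cf mX.
have m1 : measurable_fun setT (fun z : T => (f z).1 : borel V).
  apply: (@continuous2_borel V C V (fun z => (f z).1)).
  - exact: cV_second_countable.
  - exact: completionB_second_countable.
  - by move=> z; apply: (continuous_comp (cf z)); exact: cvg_fst.
have m2 : measurable_fun setT (fun z : T => (f z).2 : borel C).
  apply: (@continuous2_borel V C C (fun z => (f z).2)).
  - exact: cV_second_countable.
  - exact: completionB_second_countable.
  - by move=> z; apply: (continuous_comp (cf z)); exact: cvg_snd.
have mf : measurable_fun setT (f : T -> T) by exact/measurable_fun_pairP.
by rewrite -[X in measurable X]setTI; exact: mf.
Qed.

Lemma add_measurableK : measurable_fun setT (fun z : T * T => (z.1 : K) + z.2 : T).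
Proof.
have addV : measurable_fun setT ((fun z => z.1 + z.2 : V) : borel V * borel V -> borel V).
  apply: (@continuous2_borel V V V (fun z => z.1 + z.2)); [exact: cV_second_countable..|].
  by move=> z; exact: add_continuous.
have addC : measurable_fun setT ((fun z => z.1 + z.2 : C) : borel C * borel C -> borel C).
  apply: (@continuous2_borel C C C (fun z => z.1 + z.2)); [exact: completionB_second_countable..|].
  exact: completionB_add_continuous.
have fst2 : measurable_fun setT (fun z : T * T => (z.1.1, z.2.1)).
  by apply: measurable_fun_pair; apply: measurableT_comp;
    [exact: measurable_fst..|exact: measurable_snd].
have snd2 : measurable_fun setT (fun z : T * T => (z.1.2, z.2.2)).
  by apply: measurable_fun_pair; apply: measurableT_comp;
    [exact: measurable_snd|exact: measurable_fst|exact: measurable_snd..].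
by apply/measurable_fun_pairP; split;
  [exact: (measurableT_comp addV fst2)|exact: (measurableT_comp addC snd2)].
Qed.

Lemma oppK_continuous : continuous (fun z : K => - z).
Proof.
move=> z U /nbhsK[e [j [e0 ejU]]]; apply/nbhsK; exists e, j; split=> // z' z1 z2.
apply: ejU; rewrite /= opprK addrC -opprB; first exact: smallN.
exact: levelCN.
Qed.

Variable lambda : {sigma_finite_measure set (borel V) -> \bar R}.
Variable muB : {sigma_finite_measure set (borel C) -> \bar R}.
Hypotheses (hlambda : is_lebesgue lambda) (hmuB : haar muB).
Hypothesis hmuB1 : muB (integersB R hA hb) = 1%E.
Local Notation mu := (lambda \x muB)%E.

Lemma product_invariant (t : K) (X : set T) : measurable X ->
  mu ((fun z : K => t + z) @^-1` X) = mu X.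
Proof.
move=> mX; pose f : T -> T := fun z : K => t + z.
have mf : measurable_fun setT f.
  have h : measurable_fun setT (fun z : T => (t : T, z)) by exact: measurable_fun_pair.
  exact: (measurableT_comp add_measurableK h).
pose m2 : measure _ _ := pushforward mu f.
rewrite -[LHS]/(m2 mf X); apply/esym; apply: product_measure_unique => // P Q mP mQ.
rewrite /m2 /= /pushforward -(lebesgue_invariant hlambda t.1 mP) -(haar_invariant hmuB t.2 mQ).
rewrite -product_measure1E.
- by [].
- by have := continuous_borel (@shift_continuousV R n t.1) => /(_ measurableT P mP); rewrite setTI.
- have cC := @shift_continuousC R n A hA hb t.2.
  by have := continuous_borel cC => /(_ measurableT Q mQ); rewrite setTI.
Qed.

Lemma compact_measure_fin (F : set K) : compact F -> (mu F < +oo)%E.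
Proof.
move=> cF; have [N NF] := compact_boundedK cF.
have cF2 : compact (snd @` F).
  by apply: continuous_compact => //; apply: continuous_subspaceT => z; exact: cvg_snd.
have mF2 : measurable (snd @` F : set (borel C)).
  by apply: closed_borel; apply: compact_closed => //; exact: metric_hausdorff.
have mbox : measurable (box (const_mx (- N%:R)) (const_mx N%:R) : set (borel V)).
  exact: (@closed_borel V _ (@box_closed _ _ _ _)).
apply: (@le_lt_trans _ _ (mu (box (const_mx (- N%:R)) (const_mx N%:R) `*` snd @` F))).
  apply: le_measure; rewrite ?inE.
  - by apply: closed_measurableK; exact: compact_closedK.
  - exact: measurableX.
  - move=> z Fz; split; last by exists z.
    have [zN _] := NF z Fz => i; rewrite !mxE -ler_norml; exact/ltW/zN.
rewrite product_measure1E //; apply: lte_mul_pinfty => //.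
  by rewrite ge0_fin_numE // lebesgue_box_fin.
by have [+ _ _] := hmuB; apply.
Qed.

(** Countably many translates of [U], by a dense set of vectors, cover [K_A]. If [U] were null, so
    would be [K_A], which contains the product of the unit cube and [Z^n[[B]]], of measure 1. *)
Lemma open_measure_gt0 (U : set K) : open U -> U !=set0 -> (0 < mu U)%E.
Proof.
move=> oU [u Uu]; rewrite lt0e measure_ge0 andbT; apply/eqP => U0.
pose X0 := box (0 : V) (const_mx 1) `*` integersB R hA hb.
have mT : (0 < mu X0)%E.
  rewrite product_measure1E.
  - rewrite hmuB1 mule1 hlambda => [|i]; rewrite ?mxE // lte_fin prodr_gt0 // => i _.
    by rewrite !mxE subr0.
  - exact: (@closed_borel V _ (@box_closed _ _ _ _)).
  - by rewrite integersB_level; apply: (@open_borel C); exact: levelC_open.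
have [l lP] := laurentG_enum hA.
pose c (qk : 'cV[rat]_n.+1 * nat) : K := (- map_mx ratr qk.1, - embed R hb (l qk.2)).
have : mu (\bigcup_(qk in setT) ((fun z : K => c qk + z) @^-1` U)) = 0%E.
  apply: measure_countable_null => [|qk _|qk _]; first exact: countableP.
    apply: open_measurableK; apply: open_comp => // z _.
    by rewrite -[c qk]opprK; under eq_fun do rewrite addrC; exact: shiftK_continuous.
  exact: (etrans (product_invariant (c qk) (open_measurableK oU)) U0).
rewrite (_ : \bigcup_(qk in _) _ = setT); last first.
  apply/seteqP; split=> // z _.
  have /nbhsK[e [j [e0 ejU]]] : nbhs u U by exact: open_nbhs_nbhs.
  have [q zq] := rat_small (z.1 - u.1) e0; have [g zg] := embed_dense (z.2 - u.2) j.
  have [k kg] := lP g; exists (q, k) => //; apply: ejU => /=.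
    by rewrite (_ : _ - _ = z.1 - u.1 - map_mx ratr q) //= -addrA addrC.
  by rewrite (_ : _ - _ = z.2 - u.2 - embed R hb g) //= kg -addrA addrC.
move=> mu0; move: mT; rewrite ltNge -mu0 le_measure ?inE //.
apply: measurableX; first exact: (@closed_borel V _ (@box_closed _ _ _ _)).
by rewrite integersB_level; apply: (@open_borel C); exact: levelC_open.
Qed.

Lemma product_sigma_finite : sigma_finite setT mu.
Proof.
have /sigma_finiteP[F [FT ndF Foo]] := sigma_finiteT lambda.
have /sigma_finiteP[G [GT ndG Goo]] := sigma_finiteT muB.
exists (fun k => F k `*` G k).
  apply/seteqP; split=> // -[x y] _.
  have [k _ Fx] : (\bigcup_k F k) x by rewrite -FT.
  have [l _ Gy] : (\bigcup_k G k) y by rewrite -GT.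
  exists (maxn k l) => //; split.
    by move: Fx; apply/subsetPset/ndF/leq_maxl.
  by move: Gy; apply/subsetPset/ndG/leq_maxr.
move=> k; have [mF Ffin] := Foo k; have [mG Gfin] := Goo k.
split; first exact: measurableX.
by rewrite product_measure1E // lte_mul_pinfty // ge0_fin_numE.
Qed.

(** [nu X = mu (A X)] is again invariant and sigma-finite, so the exchange formula gives
    [mu E * nu X = mu X * nu (- E)]. The compact set [E] is a normalisation: [mu E] is finite and
    positive and [nu (- E)] is finite, hence [c = nu (- E) / mu E]. *)
Lemma actA_scales (E : set K) : compact E -> (0 < mu E)%E ->
  exists2 c : R, 0 <= c & forall X : set K, measurable (X : set T) ->
    mu (actA @` X) = (c%:E * mu X)%E.
Proof.
move=> cE E0; pose mV : T -> T := @actV R n A hA hb.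
have actAE (X : set K) : actA @` X = @actV R n A hA hb @^-1` X.
  apply/seteqP; split=> z /= => [[w Xw <-]|Xz]; first by rewrite actAK.
  by exists (actV z) => //; rewrite actVK.
have mmV : measurable_fun setT mV.
  move=> _ X mX; rewrite setTI; apply: (continuous_measurableK (f := @actV R n A hA hb)) => //.
  exact: actV_continuous.
pose m2 : measure _ _ := pushforward mu mV.
pose nu : {measure set T -> \bar R} := m2 mmV.
have /sigma_finiteP[G [GT _ Goo]] : sigma_finite setT mu.
  exact: product_sigma_finite.
have nuE (X : set K) : nu X = mu (actA @` X) by rewrite actAE.
have nu_sf : sigma_finite setT nu.
  exists (fun k => (actA : T -> T) @^-1` G k).
    by rewrite -preimage_bigcup -GT preimage_setT.
  move=> k; have [mG Gfin] := Goo k; split.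
    by apply: (continuous_measurableK (f := actA)) => //; exact: actA_continuous.
  rewrite nuE (_ : actA @` _ = G k) //.
  by rewrite actAE; apply/seteqP; split=> z /=; rewrite actVK.
pose nu' : {sigma_finite_measure set T -> \bar R} :=
  HB.pack (nu : set T -> \bar R) (Measure.class nu) (Measure_isSigmaFinite.Build _ _ _ nu nu_sf).
pose mu0 : {measure set T -> \bar R} := mu.
pose mu' : {sigma_finite_measure set T -> \bar R} :=
  HB.pack (mu0 : set T -> \bar R) (Measure.class mu0)
    (Measure_isSigmaFinite.Build _ _ _ mu0 product_sigma_finite).
have mu_inv : invariant_measure (fun x y : T => (x : K) + y) mu.
  by move=> t X; exact: product_invariant.
have nu_inv : invariant_measure (fun x y : T => (x : K) + y) nu'.
  move=> t X mX; rewrite [LHS]nuE [RHS]nuE !actAE.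
  rewrite -[RHS](product_invariant (actA t)); last first.
    by apply: (continuous_measurableK (f := @actV R n A hA hb)) => //; exact: actV_continuous.
  congr (mu _); apply/seteqP; split=> z /=; rewrite -[X in actA t + X]actVK -actAD !actAK //.
pose oppT : T -> T := fun z : K => - z.
have oppm : measurable_fun setT oppT.
  move=> _ X mX; rewrite setTI; apply: (continuous_measurableK (f := fun z : K => - z)) => //.
  exact: oppK_continuous.
have mE : measurable (E : set T) by apply: closed_measurableK; exact: compact_closedK.
have Efin := compact_measure_fin cE.
have cNE : compact ((fun z : K => - z) @` E).
  by apply: continuous_compact => //; apply: continuous_subspaceT; exact: oppK_continuous.
have NEfin : (nu (oppT @^-1` E) < +oo)%E.
  rewrite nuE; apply: compact_measure_fin; apply: continuous_compact.
    by apply: continuous_subspaceT; exact: actA_continuous.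
  rewrite (_ : oppT @^-1` E = (fun z : K => - z) @` E) //.
  apply/seteqP; split=> z /= => [Ez|[w Ew <-]]; last by rewrite /oppT opprK.
  by exists (- z); rewrite ?opprK.
have key X : measurable (X : set T) -> (mu E * nu X = mu X * nu (oppT @^-1` E))%E.
  move=> mX; apply: (@invariant_measure_exchange _ T R (fun x y : T => (x : K) + y) oppT
    _ _ _ _ add_measurableK oppm mu' nu' mu_inv nu_inv) => //.
  - by move=> x y; exact: addrC.
  - by move=> x; exact: opprK.
  - by move=> x y; exact: addKr.
  - by move=> x y; exact: opprD.
have Er : mu E = (fine (mu E))%:E by rewrite fineK // ge0_fin_numE.
have Nr : nu (oppT @^-1` E) = (fine (nu (oppT @^-1` E)))%:E by rewrite fineK // ge0_fin_numE.
have e0 : 0 < fine (mu E) by rewrite fine_gt0 // E0.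
exists (fine (nu (oppT @^-1` E)) / fine (mu E)).
  by rewrite divr_ge0 // fine_ge0.
move=> X mX; rewrite -nuE; have := key X mX; rewrite Er Nr => eq.
rewrite EFinM -muleA [X in (_ * X)%E]muleC muleA [X in (X * _)%E]muleC -eq.
by rewrite muleAC -EFinM divff ?gt_eqF // mul1e.
Qed.

End ProductMeasure.

(** * Tiles and digit expansions *)

Section DigitTiles.
Variables (R : realType) (n : nat) (A : 'M[rat]_n.+1) (hA : expanding A).
Hypothesis hb : (2 <= residue_card A^-1)%N.
Local Notation K := (KA R hA hb).
Local Notation phi := (phi R hA hb).
Local Notation actA := (@actA R n A hA hb).
Local Notation actV := (@actV R n A hA hb).
Implicit Types (z s t : K) (F S U : set K).

Lemma translateE (X : set K) s : translate X s = (fun z => z - s) @^-1` X.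
Proof.
apply/seteqP; split=> z /= => [[w Xw <-]|Xz]; first by rewrite addrK.
by exists (z - s) => //; rewrite subrK.
Qed.

Lemma translateD (X : set K) s t : translate (translate X s) t = translate X (s + t).
Proof.
rewrite !translateE; have E z : z - (s + t) = z - t - s by rewrite opprD [- s + _]addrC addrA.
by apply/seteqP; split=> z /=; rewrite E.
Qed.

Lemma iter_actAE k (X : set K) : iter k actA @` X = iter k actV @^-1` X.
Proof.
apply/seteqP; split=> z /= => [[w Xw <-]|Xz]; first by rewrite iter_actAK.
by exists (iter k actV z) => //; rewrite iter_actVK.
Qed.

Lemma iter_actA_translate k (X : set K) s :
  iter k actA @` translate X s = translate (iter k actA @` X) (iter k actA s).
Proof.
rewrite !iter_actAE !translateE; apply/seteqP; split=> z /=.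
  by rewrite iter_actVB iter_actAK.
by rewrite iter_actVB iter_actAK.
Qed.

Definition Gamma : set K := [set phi g | g in [set g : laurentG hA | adjoin A (lval g)]].

Lemma Gamma0 : Gamma 0.
Proof. by exists 0; [exact: adjoin0|exact: phi0]. Qed.

Lemma GammaB x y : Gamma x -> Gamma y -> Gamma (x - y).
Proof.
by move=> [g gA <-] [h hA' <-]; exists (g - h); [exact: adjoinB|exact: phiB].
Qed.

Lemma Gamma_actA x : Gamma x -> Gamma (actA x).
Proof.
move=> [g gA <-]; exists (laurent_mulA g); last by rewrite actA_phi.
exact: adjoin_mul.
Qed.

Lemma countable_Gamma : countable Gamma.
Proof.
apply: sub_countable (card_image_le _ _) _.
apply: sub_countable (laurentG_countable hA); exact: subset_card_le.
Qed.

Lemma levelC_embed_adjoin (g : laurentG hA) :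
  levelC 0 (embed R hb g) -> adjoin A^-1 (lval g).
Proof.
rewrite /levelC /= nuC_embed => g0; have [|ng] := pselect (filtr A^-1 0 (lval g)).
  by move=> [y yB <-]; rewrite expr0z mul1mx.
have : (nu R g <= (-1)%:~R%:E)%E.
  by apply: ereal_inf_lbound; exists (-1).
by move=> /(le_trans g0); rewrite lee_fin ler_int.
Qed.

(** Let [phi g = x - y]. Level [0] in the second coordinate puts [g] in both [Z^n[A]] and [Z^n[B]],
    so [N g] is integral; the radius [e = 1 / (2 N)] makes its coordinates smaller than 1 in
    absolute value, so [g = 0]. In this form [U] is the initial [Gamma]-packing. *)
Lemma Gamma_discrete : exists2 U : set K, open U /\ U 0 &
  forall x y, U x -> U y -> Gamma (x - y) -> x = y.
Proof.
have [N N0 NP] := adjoin_cap_inv_denominator (expanding_unit hA).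
pose e : R := (2 * N%:R)^-1; have Nr : 0 < N%:R :> R by rewrite ltr0n.
have e0 : 0 < e by rewrite invr_gt0 mulr_gt0.
have ee : (e + e) * N%:R = 1.
  by rewrite /e; field; rewrite gt_eqF.
exists ([set z | small z.1 e /\ levelC 0 z.2]°).
  split; first exact: open_interior.
  by apply/nbhsK; exists e, 0%N; split=> // z; rewrite !subr0.
move=> x y /interior_subset[x1 x2] /interior_subset[y1 y2] [g gA gE].
have gB : adjoin A^-1 (lval g).
  apply: levelC_embed_adjoin.
  have -> : embed R hb g = x.2 - y.2 by have := congr1 snd gE.
  exact: levelCB.
have [c gc] := NP _ gA gB.
suff g0 : g = 0 by apply/eqP; rewrite -subr_eq0 -gE g0 phi0.
apply/val_inj/matrixP => i j; rewrite (ord1 j) [RHS]mxE.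
have : `|(phi g).1 i ord0| < e + e.
  by rewrite gE; exact: (smallD x1 (smallN y1)).
rewrite mxE -(ltr_pM2r Nr) ee -{1}(ger0_norm (ltW Nr)) -normrM.
have cE : (c i ord0)%:~R = N%:R * lval g i ord0 by have /matrixP/(_ i ord0) := gc; rewrite !mxE.
have -> : ratr (lval g i ord0) * N%:R = (c i ord0)%:~R :> R.
  by rewrite -(ratr_int R) cE rmorphM /= ratr_nat mulrC.
rewrite -intr_norm -[1]/(1%:~R) ltr_int => c1.
have c0 : c i ord0 = 0 by lia.
move/eqP: cE; rewrite c0 eq_sym mulf_eq0 pnatr_eq0.
by case/orP=> [/eqP N00|/eqP//]; move: N0; rewrite N00.
Qed.

Variable D : set 'cV[rat]_n.+1.
Hypothesis hD : digit_set A D.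

Definition expansionsK k : set K :=
  [set phi g | g in [set g : laurentG hA | expansions A D k (lval g)]].
Definition digitsK : set K := [set phi g | g in [set g : laurentG hA | D (lval g)]].

Lemma expansionsS k (x : 'cV[rat]_n.+1) : expansions A D k.+1 x <->
  exists d y, [/\ D d, expansions A D k y & x = d + A *m y].
Proof.
split=> [[d dD ->]|[d0 [_ [Dd0 [d dD ->] ->]]]].
  exists (d 0%N), (\sum_(i < k) A ^+ i *m d i.+1); split; first exact: dD.
    by exists (fun i => d i.+1) => // i ik; apply: dD.
  rewrite big_ord_recl mul1mx; congr (_ + _); rewrite mulmx_sumr.
  by apply: eq_bigr => i _; rewrite /= /bump add1n exprS -[_ * _]/(A *m _) mulmxA.
exists (fun i => if i is j.+1 then d j else d0); first by case=> // i; exact: dD.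
rewrite big_ord_recl mul1mx; congr (_ + _); rewrite mulmx_sumr.
by apply: eq_bigr => i _; rewrite /= /bump add1n exprS -[_ * _]/(A *m _) mulmxA.
Qed.

Lemma expansions_adjoin k (x : 'cV[rat]_n.+1) : expansions A D k x -> adjoin A x.
Proof.
elim: k x => [|k IH] x; first by move=> [d _ ->]; rewrite big_ord0; exact: adjoin0.
move=> /expansionsS[d [y [Dd yk ->]]]; apply: adjoinD; first exact: hD.1.
exact/adjoin_mul/IH.
Qed.

Lemma lift_adjoin v : adjoin A v -> exists g : laurentG hA, lval g = v.
Proof.
move=> /(adjoin_laurent hA) vB; have vP : v \in laurent_pred hA by apply/asboolP.
by exists (LaurentG vP).
Qed.

Lemma expansionsK0 : expansionsK 0 = [set 0].
Proof.
apply/seteqP; split=> [_ [g [d _ g0] <-]|_ ->].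
  by rewrite (_ : g = 0) ?phi0 //; apply: val_inj; rewrite /= g0 big_ord0.
exists 0; last exact: phi0.
by exists (fun=> 0) => //; rewrite big_ord0.
Qed.

Lemma digit_expansionsK k s t : digitsK s -> expansionsK k t -> expansionsK k.+1 (s + actA t).
Proof.
move=> [d Dd <-] [g gk <-]; exists (d + laurent_mulA g); last by rewrite phiD actA_phi.
by apply/expansionsS; exists (lval d), (lval g); split.
Qed.

Lemma expansionsK_inv k s : expansionsK k.+1 s ->
  exists d t, [/\ digitsK d, expansionsK k t & s = d + actA t].
Proof.
move=> [g /expansionsS[d [y [Dd yk gE]]] <-].
have [d' d'E] := lift_adjoin (hD.1 _ Dd).
have [y' y'E] := lift_adjoin (expansions_adjoin yk).
exists (phi d'), (phi y'); split.
- by exists d' => //=; rewrite d'E.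
- by exists y' => //=; rewrite y'E.
- by rewrite actA_phi -phiD; congr phi; apply: val_inj; rewrite /= gE -d'E -y'E.
Qed.

Lemma expansionsK_Gamma k s : expansionsK k s -> Gamma s.
Proof. by move=> [g gk <-]; exists g => //; exact: expansions_adjoin gk. Qed.

Lemma expansionsK_cat k l s t : expansionsK k s -> expansionsK l t ->
  expansionsK (k + l) (s + iter k actA t).
Proof.
elim: k s => [|k IH] s; first by rewrite expansionsK0 => ->; rewrite add0r.
move=> /expansionsK_inv[d [s' [Dd s'k ->]]] tl.
by rewrite iterS -addrA -actAD; apply: digit_expansionsK => //; exact: IH.
Qed.

Lemma DeltaP s : Delta R hA hb D s <->
  exists2 k, (1 <= k)%N & exists x y, [/\ expansionsK k x, expansionsK k y & s = x - y].
Proof.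
split=> [[k k1 [g [d [d' [dk d'k gE]]] <-]]|[k k1 [_ [_ [[g gk <-] [h hk <-] ->]]]]].
  exists k => //; have [x xE] := lift_adjoin (expansions_adjoin dk).
  have [y yE] := lift_adjoin (expansions_adjoin d'k).
  exists (phi x), (phi y); split.
  - by exists x => //=; rewrite xE.
  - by exists y => //=; rewrite yE.
  - by rewrite -phiB; congr phi; apply: val_inj; rewrite /= gE xE yE.
exists k => //; exists (g - h); last exact: phiB.
by exists (lval g), (lval h).
Qed.

Variable F : set K.
Hypothesis hF : rational_tile D F.

Lemma tile_actA : actA @` F = \bigcup_(d in digitsK) translate F d.
Proof.
have [_ _ ->] := hF; apply/seteqP; split=> z.
  by move=> [d Dd Fz]; exists (phi d) => //; exists d.
by move=> [_ [d Dd <-] Fz]; exists d.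
Qed.

Lemma tile_iter k : iter k actA @` F = \bigcup_(s in expansionsK k) translate F s.
Proof.
elim: k => [|k IH].
  rewrite expansionsK0 bigcup_set1 translateE image_id.
  by apply/seteqP; split=> z /=; rewrite subr0.
have -> : iter k.+1 actA @` F = actA @` (iter k actA @` F) by rewrite -image_comp.
rewrite IH; apply/seteqP; split=> z.
  move=> [_ [s sk [w Fw <-]] <-].
  have : (actA @` F) (actA w) by exists w.
  rewrite tile_actA => -[d Dd [w' Fw' E]]; exists (d + actA s); first exact: digit_expansionsK.
  by exists w' => //; rewrite actAD -E addrA.
move=> [_ /expansionsK_inv[d [t [Dd tk ->]]] [w Fw <-]].
have : (\bigcup_(d in digitsK) translate F d) (w + d) by exists d => //; exists w.
rewrite -tile_actA => -[w' Fw' E].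
exists (w' + t); first by exists t => //; exists w'.
by rewrite actAD E addrA.
Qed.

Lemma tile_iter_translate k s :
  iter k actA @` translate F s = \bigcup_(x in expansionsK k) translate F (x + iter k actA s).
Proof.
rewrite iter_actA_translate tile_iter; apply/seteqP; split=> z.
  by move=> [w [x xk Fw] <-]; exists x => //; rewrite -translateD; exists w.
by move=> [x xk]; rewrite -translateD => -[w Fw <-]; exists w => //; exists x.
Qed.

Lemma finite_digitsK : finite_set digitsK.
Proof.
have fD : finite_set D by exists (residue_card A); exact: hD.2.
apply: finite_image; apply: (finite_preimage (f := lval)) => //.
by move=> x y _ _; exact: val_inj.
Qed.

Lemma finite_expansionsK k : finite_set (expansionsK k).
Proof.
elim: k => [|k IH]; first by rewrite expansionsK0.
apply: (@sub_finite_set _ _ [set s + actA t | s in digitsK & t in expansionsK k]).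
  by move=> s /expansionsK_inv[d [t [Dd tk ->]]]; exists d => //; exists t.
exact: finite_image2 finite_digitsK IH.
Qed.

End DigitTiles.

(** * Periodic points and inflation *)

Section SelfReplication.
Variables (R : realType) (n : nat) (A : 'M[rat]_n.+1) (hA : expanding A).
Hypothesis hb : (2 <= residue_card A^-1)%N.
Local Notation K := (KA R hA hb).
Local Notation phi := (phi R hA hb).
Local Notation actA := (@actA R n A hA hb).
Local Notation actV := (@actV R n A hA hb).
Implicit Types (z s t : K) (S U : set K).
Variable D : set 'cV[rat]_n.+1.
Hypothesis hD : digit_set A D.
Variable F : set K.
Hypothesis hF : rational_tile D F.
Local Notation expansionsK := (@expansionsK R n A hA hb D).
Local Notation Gamma := (@Gamma R n A hA hb).

Lemma iter_actV_cvg0 z (U : set K) : nbhs (0 : K) U ->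
  exists k0 : nat, forall k, (k0 <= k)%N -> U (iter k actV z).
Proof.
move=> /nbhsK[e [j [e0 ejU]]].
have [|N NP] := @compact_boundedK R n A hA hb [set z]; first exact: compact_set1.
have [zN zl] := NP z erefl.
have [k0 k0P] := actV_contracts hA hb N j e0; exists k0 => k kk.
by have [? ?] := k0P k z kk zN zl; apply: ejU; rewrite subr0.
Qed.

Lemma tile_contracts (e : R) (j : nat) : 0 < e -> exists k0 : nat,
  forall k z t, (k0 <= k)%N -> F z -> F t ->
    small (iter k actV z - iter k actV t).1 e /\
    levelC j (iter k actV z - iter k actV t).2.
Proof.
move=> e0; have [cF _ _] := hF; have [N NP] := compact_boundedK cF.
have [k0 k0P] := actV_contracts hA hb (N + N) j e0; exists k0 => k z t kk Fz Ft.
have [zN zl] := NP z Fz; have [tN tl] := NP t Ft.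
rewrite -iter_actVB; apply: k0P => //=.
  by rewrite natrD; apply: smallD => //; exact: smallN.
by apply: levelC_le (levelCB zl tl); lia.
Qed.

(** [F] is the union of its pieces [A^-k (F + d)], and these shrink uniformly as [k] grows; the
    piece containing [z] ends up inside [U]. *)
Lemma small_copy z U : F z -> nbhs z U -> exists2 k, (1 <= k)%N &
  exists2 d, expansionsK k d & forall t, F t -> U (iter k actV (t + d)).
Proof.
move=> Fz /nbhsK[e [j [e0 ejU]]]; have [k0 k0P] := tile_contracts j e0.
exists k0.+1 => //; have : (iter k0.+1 actA @` F) (iter k0.+1 actA z) by exists z.
rewrite (tile_iter hD hF) => -[d dk [w Fw wE]]; exists d => // t Ft.
have := k0P _ t w (leqnSn k0) Ft Fw; rewrite -iter_actVB.
rewrite (_ : t - w = (t + d) - (w + d)); last by rewrite opprD addrACA subrr addr0.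
by rewrite iter_actVB wE iter_actAK => -[? ?]; exact: ejU.
Qed.

(* A contraction of the tile cannot move every point by a definite amount: the
   displacement along an orbit tends to zero. *)
Lemma periodic_point U : open U -> U !=set0 -> U `<=` F ->
  exists2 k, (1 <= k)%N &
    exists2 d, expansionsK k d & exists2 p, U p & iter k actA p = p + d.
Proof.
move=> oU [u Uu] UF; have uU : nbhs u U by exact: open_nbhs_nbhs.
(* The map [f] sends [F] into [U], which lies in [F]. A fixed point of [f] in [F] is therefore
   automatically in [U], and it satisfies [A^k p = p + d]. *)
have [k k1 [d dk dU]] := small_copy (UF _ Uu) uU.
exists k => //; exists d => //; pose f z : K := iter k actV (z + d).
suff [p Fp pE] : exists2 p, F p & f p = p.
  exists p; first by rewrite -pE; exact: dU.
  by rewrite -{1}pE /f iter_actVK.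
have [cF [u0 Fu0] _] := hF.
pose G z : K := f z - z.
have iter_cont m : continuous (iter m actV).
  elim: m => [|m IH] z; first exact: cvg_id.
  by apply: (@continuous_comp _ _ _ (iter m actV) actV); [exact: IH|exact: actV_continuous].
have fE z : f z = iter k actV z - iter k actV (- d).
  by rewrite -iter_actVB opprK.
have Gcont : continuous G.
  move=> z W /= /nbhsK[e [j [e0 ejW]]].
  have e20 : 0 < e / 2 by rewrite divr_gt0.
  have : nbhs (iter k actV z) [set z' : K |
      small (z'.1 - (iter k actV z).1) (e / 2) /\ levelC j (z'.2 - (iter k actV z).2)].
    by apply/nbhsK; exists (e / 2), j.
  move=> /(iter_cont k z)/nbhsK[e' [j' [e'0 ej']]].
  apply/nbhsK; exists (Num.min e' (e / 2)), (maxn j j'); split; first by rewrite lt_min e'0.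
  move=> z' z1 z2; have [] := ej' z'.
  - by move=> i; have := z1 i; rewrite lt_min => /andP[].
  - by apply: levelC_le z2; rewrite lez_nat leq_maxr.
  move=> /= h1 h2; have GE : G z' - G z = (iter k actV z' - iter k actV z) - (z' - z).
    have sub4 (a b c v w : K) : (a - c - v) - (b - c - w) = (a - b) - (v - w).
      rewrite [a - c - v]addrAC [b - c - w]addrAC opprB addrA subrK !opprB.
      by rewrite addrACA [RHS]addrACA; congr (_ + _); exact: addrC.
    by rewrite /G !fE sub4.
  have Gz1 : small (G z' - G z).1 e.
    rewrite GE [e]splitr; apply: smallD => //; apply: smallN => i.
    by have := z1 i; rewrite lt_min => /andP[].
  have Gz2 : levelC j (G z' - G z).2.
    by rewrite GE; apply: levelCB => //; apply: levelC_le z2; rewrite lez_nat leq_maxl.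
  exact: ejW Gz1 Gz2.
have [[p Fp pE]|G0] := pselect ((G @` F) 0).
  by exists p => //; apply/eqP; rewrite -subr_eq0 -/(G p) pE.
have clG : closed (G @` F).
  apply: compact_closedK; apply: continuous_compact => //.
  exact: continuous_subspaceT.
have /nbhsK[e [j [e0 ej]]] : nbhs (0 : K) (~` (G @` F)).
  by apply: open_nbhs_nbhs; split=> //; exact: closed_openC.
have [k0 k0P] := tile_contracts j e0.
pose x i := iter i f u0.
have xF i : F (x i) by elim: i => //= i IH; apply: UF; exact: dU.
have xE i z t : iter i f z - iter i f t = iter (i * k) actV z - iter (i * k) actV t.
  have fB a b : f a - f b = iter k actV (a - b).
    by rewrite !fE opprD opprK addrACA addNr addr0 iter_actVB.
  by elim: i => //= i IH; rewrite mulSn !iterD fB IH iter_actVB.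
(* The displacement at [x k0] is [A^-(k0 k)] applied to the first displacement [x 1 - x 0], and
   [k0 * k >= k0] since [k >= 1]. *)
have [] := k0P (k0 * k)%N (x 1%N) (x 0%N) _ (xF _) (xF _).
  by rewrite leq_pmulr.
rewrite -xE -[iter k0 f (x 1%N)]/(iter k0 f (f u0)) -iterSr => h1 h2; exfalso.
apply: (ej (G (x k0))); rewrite ?subr0 //.
by exists (x k0).
Qed.

(** * The increasing tower of inflated tiles around the periodic point *)

Section Tower.
Variables (U : set K) (k : nat) (d p : K).
Hypotheses (oU : open U) (UF : U `<=` F) (k1 : (1 <= k)%N).
Hypotheses (dk : expansionsK k d) (Up : U p) (pE : iter k actA p = p + d).

(** This is [d + A^k d + ... + A^((i-1)k) d], obtained by iterating [- p = d + A^k (- p)] [i] times.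
    Hence [A^(ik) (F - p)] is the union of the tiles [F + e - offset i - p] with [e] in [D_(ik)]. *)
Fixpoint offset i : K := if i is j.+1 then offset j + iter (j * k) actA d else 0.

Lemma offset_expansionsK i : expansionsK (i * k) (offset i).
Proof.
elim: i => [|i IH]; first by rewrite mul0n expansionsK0.
by rewrite mulSn addnC; exact: expansionsK_cat.
Qed.

Lemma offsetE i : - p = offset i + iter (i * k) actA (- p).
Proof.
have pN : - p = d + iter k actA (- p).
  have -> : iter k actA (- p) = - iter k actA p.
    by apply/eqP; rewrite -addr_eq0 -iter_actAD addNr; elim: (k) => //= m /eqP ->; rewrite actA0.
  by rewrite pE opprD addrCA subrr addr0.
elim: i => [|i IH]; first by rewrite mul0n add0r.
by rewrite [LHS]IH {1}pN iter_actAD -iterD addrA mulSn addnC.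
Qed.

(** The translations of the tiles in [A^(ik) (F - p)], moved by [p]. Without this shift by [p] they
    are differences of two elements of [D_(ik)], hence lie in [Delta]. *)
Definition stage i : set K := [set e - offset i | e in expansionsK (i * k)].
Definition translations : set K := \bigcup_(i in [set i | (1 <= i)%N]) stage i.

(** Appending the digit block of [d] to [e] adds [A^(jk) d], exactly the term gained by the next
    offset. *)
Lemma stage_le i j : (i <= j)%N -> stage i `<=` stage j.
Proof.
elim: j => [|j IH]; first by rewrite leqn0 => /eqP ->.
rewrite leq_eqVlt => /orP[/eqP -> //|/IH ij] _ /ij[e ej <-].
exists (e + iter (j * k) actA d); last by rewrite /= opprD addrACA subrr addr0.
by rewrite mulSn addnC; exact: expansionsK_cat.
Qed.

Lemma translations_Delta : translations `<=` Delta R hA hb D.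
Proof.
move=> _ [i i1 [e ei <-]]; apply/(DeltaP hD); exists (i * k)%N; first by rewrite muln_gt0 i1.
by exists e, (offset i); split => //; exact: offset_expansionsK.
Qed.

Lemma translations_common s t : translations s -> translations t ->
  exists i, stage i s /\ stage i t.
Proof.
move=> [i _ si] [j _ tj]; exists (maxn i j).
by split; [apply: stage_le si; exact: leq_maxl|apply: stage_le tj; exact: leq_maxr].
Qed.

Lemma shifted_stage i e : e - offset i + - p = e + iter (i * k) actA (- p).
Proof. by rewrite {1}(offsetE i) addrA subrK. Qed.

Lemma translations_cover z : exists2 s, translations s & translate F (s - p) z.
Proof.
have [k0 k0P] : exists k0 : nat, forall m, (k0 <= m)%N -> translate F (- p) (iter m actV z).
  apply: iter_actV_cvg0.
  have : nbhs (0 : K) ((fun z => z - - p) @^-1` U).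
    by apply: shiftK_continuous; rewrite opprK add0r; exact: open_nbhs_nbhs.
  by apply: filterS => w /= Uw; rewrite translateE; exact: UF.
(* [k0.+1] rather than [k0], because [translations] collects the stages from index 1 on. *)
have : (iter (k0.+1 * k) actA @` translate F (- p)) z.
  exists (iter (k0.+1 * k) actV z); last by rewrite iter_actVK.
  by apply: k0P; rewrite (leq_trans (leqnSn k0)) // leq_pmulr.
rewrite (tile_iter_translate hD hF) => -[x xk Fz].
exists (x - offset k0.+1); first by exists k0.+1 => //; exists x.
by rewrite shifted_stage.
Qed.

(** For [s = e + A^(ik) (- p)], the tiles of [A^k (F + s)] have translations
    [x + A^k e + A^((i+1)k) (- p)] with [x] in [D_k]. Concatenating digits puts [x + A^k e] in
    [D_((i+1)k)], so they come from stage [i + 1]. *)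
Lemma translations_replicate s : translate translations (- p) s ->
  exists J : set K, [/\ finite_set J, J `<=` translate translations (- p) &
    iter k actA @` translate F s = \bigcup_(s' in J) translate F s'].
Proof.
move=> [_ [i i1 [e ei <-]] <-]; rewrite shifted_stage.
exists [set x + iter k actA (e + iter (i * k) actA (- p)) | x in expansionsK k]; split.
- by apply: finite_image; exact: finite_expansionsK.
- move=> _ [x xk <-]; exists (x + iter k actA e - offset i.+1).
    by exists i.+1 => //; exists (x + iter k actA e) => //; rewrite mulSn; exact: expansionsK_cat.
  by rewrite shifted_stage iter_actAD -iterD mulSn addrA.
- by rewrite (tile_iter_translate hD hF) [RHS]bigcup_image.
Qed.

Lemma translations0 : translations 0.
Proof.
by exists 1%N => //; exists (offset 1); [exact: offset_expansionsK|rewrite subrr].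
Qed.

(** A by-product of the tower: the unshifted translations are differences of digit expansions, hence
    in [Gamma]. Covering [z - p] by the shifted tiles is covering [z] by the unshifted ones. *)
Lemma tile_Gamma_cover z : exists2 g, Gamma g & translate F g z.
Proof.
have [s [i i1 [e ei <-]] Fz] := translations_cover (z - p).
exists (e - offset i); last first.
  by move: Fz; rewrite !translateE /= opprD addrA addrAC opprK subrK.
exact: GammaB (expansionsK_Gamma hD ei) (expansionsK_Gamma hD (offset_expansionsK _)).
Qed.

End Tower.

(** Without digits the set equation would make [A F] an empty union, against [F] being nonempty. *)
Lemma residue_card_gt0 : (0 < residue_card A)%N.
Proof.
have [_ [z Fz] FE] := hF; rewrite lt0n; apply/eqP => a0.
have [_] := hD; rewrite a0 II0 card_eq0 => /eqP D0.
have : (actA @` F) (actA z) by exists z.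
by rewrite FE D0 preimage_set0 bigcup_set0.
Qed.

Lemma digits_enum : exists g : nat -> laurentG hA,
  @digitsK R n A hA hb D = [set phi (g i) | i in `I_(residue_card A)].
Proof.
have [DA Da] := hD.
have /card_set_bijP[f [fD _ fs]] : (`I_(residue_card A) #= D)%card by rewrite card_eq_sym.
have /choice[g gP] : forall i, exists g : laurentG hA, (i < residue_card A)%N -> lval g = f i.
  move=> i; have [ia|_] := boolP (i < residue_card A)%N; last by exists 0.
  by have [g gE] := lift_adjoin hA (DA _ (fD i ia)); exists g.
exists g; apply/seteqP; split=> [_ [x Dx <-]|_ [i ia <-]].
  have [i ia fi] := fs _ Dx; exists i => //; congr phi; apply: val_inj.
  by rewrite /= gP.
by exists (g i) => //=; rewrite gP //; exact: fD.
Qed.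

Lemma residue_representatives : exists g : nat -> laurentG hA,
  (forall i, (i < residue_card A)%N -> adjoin A (lval (g i))) /\
  forall i j h, (i < residue_card A)%N -> (j < residue_card A)%N -> adjoin A h ->
    lval (g i) - lval (g j) = A *m h -> i = j.
Proof.
have a0 := residue_card_gt0.
pose H := [set A *m x | x in adjoin A].
pose X := coset_set (adjoin A) H.
have fX : finite_set X.
  (* [fset_set] sends an infinite set to the empty one, so a positive [residue_card] forces the
     quotient to be finite. *)
  apply: contrapT => nX; move: a0; rewrite /residue_card /fset_set.
  by case: pselect => // _; rewrite cardfs0.
pose s : seq (set 'cV[rat]_n.+1) := fset_set X.
have sX i : (i < residue_card A)%N -> X (nth set0 s i).
  by move=> ia; have := mem_nth set0 ia; rewrite in_fset_set // inE.
have /choice[g gP] : forall i, exists g : laurentG hA, (i < residue_card A)%N ->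
    adjoin A (lval g) /\ nth set0 s i = [set lval g + h | h in H].
  move=> i; have [ia|_] := boolP (i < residue_card A)%N; last by exists 0.
  have [x xA xE] := sX i ia; have [g gE] := lift_adjoin hA xA; exists g => _.
  by rewrite gE.
exists g; split=> [i /gP[]//|i j h ia ja hh gE].
have [_ iE] := gP i ia; have [_ jE] := gP j ja.
have /eqP : nth set0 s i = nth set0 s j.
  rewrite iE jE; have gij : lval (g i) = lval (g j) + A *m h by rewrite -gE addrC subrK.
  apply/seteqP; split=> [_ [_ [y yA <-] <-]|_ [_ [y yA <-] <-]].
    exists (A *m (h + y)); last by rewrite mulmxDr addrA -gij.
    by exists (h + y) => //; exact: adjoinD.
  exists (A *m (y - h)); last by rewrite gij mulmxBr addrA addrAC addrK addrC.
  by exists (y - h) => //; exact: adjoinB.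
by rewrite nth_uniq ?fset_uniq // => /eqP.
Qed.

End SelfReplication.

(** * Measure of the tile *)

Section TileMeasure.
Variables (R : realType) (n : nat) (A : 'M[rat]_n.+1) (hA : expanding A).
Hypothesis hb : (2 <= residue_card A^-1)%N.
Local Notation C := (completionB R hA hb).
Local Notation V := 'cV[R]_n.+1.
Local Notation K := (KA R hA hb).
Local Notation T := (borel V * borel C)%type.
Local Notation phi := (phi R hA hb).
Local Notation actA := (@actA R n A hA hb).
Local Notation actV := (@actV R n A hA hb).
Local Notation Gamma := (@Gamma R n A hA hb).
Implicit Types (z s t : K) (S U X : set K).
Variables (mu : {measure set T -> \bar R}) (c : R).
Hypothesis mu_invariant : forall t X, measurable (X : set T) ->
  mu ((fun z : K => t + z) @^-1` X) = mu X.
Hypothesis mu_open : forall U, open U -> U !=set0 -> (0 < mu U)%E.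
Hypothesis mu_compact : forall X, compact X -> (mu X < +oo)%E.
Hypothesis c_ge0 : 0 <= c.
Hypothesis mu_actA : forall X, measurable (X : set T) ->
  mu (actA @` X) = (c%:E * mu X)%E.

Lemma measurable_translate X s : measurable (X : set T) ->
  measurable (translate X s : set T).
Proof.
move=> mX; rewrite translateE.
apply: (continuous_measurableK (f := fun z => z - s)) => //.
exact: shiftK_continuous.
Qed.

Lemma mu_translate X s : measurable (X : set T) -> mu (translate X s) = mu X.
Proof.
move=> mX; rewrite translateE -[RHS](mu_invariant (- s)) //; congr (mu _).
by apply/seteqP; split=> z /=; rewrite addrC.
Qed.

Lemma actAE X : actA @` X = actV @^-1` X.
Proof. exact: (iter_actAE 1). Qed.

Lemma measurable_actA X : measurable (X : set T) -> measurable (actA @` X : set T).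
Proof.
move=> mX; rewrite actAE; apply: (continuous_measurableK (f := actV)) => //.
exact: actV_continuous.
Qed.

(** Cut [P] into disjoint pieces, the [k]-th inside [F + g k], and move each back into [F] by
    [- g k]. The pieces remain disjoint because distinct points of [P] never differ by an element of
    [Gamma]; total measure is preserved by invariance. *)
Lemma packing_le_covering (P F : set K) : measurable (P : set T) -> measurable (F : set T) ->
  (forall x y, P x -> P y -> Gamma (x - y) -> x = y) ->
  (forall z, exists2 g, Gamma g & translate F g z) ->
  (mu P <= mu F)%E.
Proof.
move=> mP mF packP coverF.
have [|g gG] := countable_range (@countable_Gamma R n A hA hb); first by exists 0; exact: Gamma0.
have gk k : Gamma (g k) by rewrite gG; exists k.
pose Q k : set T := P `&` translate F (g k).
have mQ k : measurable (Q k) by apply: measurableI => //; exact: measurable_translate.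
have PQ : P = \bigcup_k Q k.
  apply/seteqP; split=> [x Px|x [k _ []] //].
  have [y yG Fx] := coverF x; move: yG; rewrite gG => -[k _ ky].
  by exists k => //; split; rewrite ?ky.
pose E k : set T := seqDU Q k.
have mE k : measurable (E k) by exact: seqDU_measurable.
pose E' k : set T := translate (E k) (- g k).
have mE' k : measurable (E' k) by exact: measurable_translate.
have EF k : E' k `<=` F.
  move=> _ [z [[_ [w Fw <-]] _] <-]; rewrite addrK //.
have E'triv : trivIset setT E'.
  apply/trivIsetP => i j _ _ ij; rewrite -subset0 => z [[x Ex xz] [y Ey yz]].
  have xy : x = y.
    apply: packP; [by have [[]] := Ex|by have [[]] := Ey|].
    have -> : x - y = g i - g j.
      apply/eqP; rewrite subr_eq; apply/eqP.
      rewrite -[x](subrK (g i)) xz -yz addrC -[RHS]addrA.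
      by congr (_ + _); exact: addrC.
    exact: GammaB.
  have /trivIsetP/(_ i j I I ij) := trivIset_seqDU Q.
  by rewrite -subset0 => /(_ x); apply; split=> //; rewrite xy.
have -> : mu P = mu (\bigcup_k E' k).
  rewrite PQ seqDU_bigcup_eq !measure_semi_bigcup //; last 2 first.
  - by apply: (@bigcup_measurable _ T).
  - by apply: (@bigcup_measurable _ T).
  by apply: eq_eseriesr => k _; rewrite /E' mu_translate.
apply: le_measure; rewrite ?inE //; first by apply: (@bigcup_measurable _ T).
by move=> z [k _]; exact: EF.
Qed.

Variable D : set 'cV[rat]_n.+1.
Hypothesis hD : digit_set A D.
Variable F : set K.
Hypothesis hF : rational_tile D F.
Hypothesis hU : exists U : set K, [/\ open U, U !=set0 & U `<=` F].
Local Notation expansionsK := (@expansionsK R n A hA hb D).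
Local Notation a := (residue_card A).

Lemma measurable_tile : measurable (F : set T).
Proof. by have [cF _ _] := hF; apply: closed_measurableK; exact: compact_closedK. Qed.
Let mF := measurable_tile.

Lemma tile_measure_fin : mu F = (fine (mu F))%:E.
Proof. by have [cF _ _] := hF; rewrite fineK // ge0_fin_numE // mu_compact. Qed.

Lemma cover_by_Gamma z : exists2 g, Gamma g & translate F g z.
Proof.
have [U [oU U0 UF]] := hU.
have [k k1 [d dk [p Up pE]]] := periodic_point hD hF oU U0 UF.
exact: (tile_Gamma_cover hD hF oU UF k1 dk Up pE).
Qed.

(* Passing from a [Gamma]-packing [P] to [A^-1 (P + representatives)] multiplies the
   measure by [a / c]. *)
Lemma packing_refine (P : set K) : measurable (P : set T) ->
  (forall x y, P x -> P y -> Gamma (x - y) -> x = y) ->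
  exists P' : set K, [/\ measurable (P' : set T),
    forall x y, P' x -> P' y -> Gamma (x - y) -> x = y &
    (c%:E * mu P' = a%:R%:E * mu P)%E].
Proof.
move=> mP packP; have [g [gA gI]] := residue_representatives hD hF.
pose W : set K := \bigcup_(i < a) translate P (phi (g i)).
have mW : measurable (W : set T).
  by apply: (@bigcup_measurable _ T) => i _; exact: measurable_translate.
have WE : actA @` (actA @^-1` W) = W.
  by rewrite actAE; apply/seteqP; split=> z /=; rewrite actVK.
have mP' : measurable (actA @^-1` W : set T).
  by apply: (continuous_measurableK (f := actA)) => //; exact: actA_continuous.
(* A congruence modulo [A Gamma] is read twice: modulo [Gamma] it gives [x = y] by the packing
   property, and then it identifies the residue classes of [g i] and [g j]. A general [v] yields the
   packing property of [P']; [v = 0] yields the disjointness of the translates of [P]. *)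
have PI x y i j (v : laurentG hA) : (i < a)%N -> (j < a)%N -> P x -> P y -> adjoin A (lval v) ->
    x + phi (g i) - (y + phi (g j)) = actA (phi v) -> i = j /\ x = y.
  move=> ia ja Px Py vA E.
  have vG : Gamma (actA (phi v)) by apply: Gamma_actA; exists v.
  have xy : x = y.
    apply: packP => //.
    have -> : x - y = actA (phi v) - (phi (g i) - phi (g j)).
      by rewrite -E opprD addrACA addrK.
    by apply: GammaB => //; apply: GammaB; [exists (g i)|exists (g j)] => //; exact: gA.
  split=> //; apply: (gI _ _ (lval v)) => //.
  have := E; rewrite xy opprD addrACA subrr add0r -phiB actA_phi => /phi_inj/(congr1 lval).
  by [].
exists (actA @^-1` W); split=> //.
  move=> x y [i ia [x' Px' x'E]] [j ja [y' Py' y'E]] [v vA vE].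
  have E : x' + phi (g i) - (y' + phi (g j)) = actA (phi v).
    by rewrite x'E y'E -actAB vE.
  have [ij xy] := PI _ _ _ _ _ ia ja Px' Py' vA E.
  move: E; rewrite ij xy subrr -[0]actA0 => /(can_inj (@actAK _ _ _ _ _)) /esym v0.
  by apply/eqP; rewrite -subr_eq0 -vE v0.
rewrite -mu_actA // WE /W bigcup_mkord measure_bigsetU_ord //.
- rewrite (eq_bigr (fun=> mu P)); last by move=> i _; exact: mu_translate.
  by rewrite sumr_const card_ord mule_natl.
- by move=> i; exact: measurable_translate.
- apply/trivIsetP => i j _ _ ij; rewrite -subset0 => z [[x Px xz] [y Py yz]].
  have [] := @PI x y i j 0 (ltn_ord i) (ltn_ord j) Px Py (@adjoin0 _ _).
    by rewrite xz yz subrr phi0 actA0.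
  by move=> /val_inj ij'; move/eqP: ij; rewrite ij'.
Qed.

(** Refining a small open packing [U] [m] times gives [a^m mu U <= c^m mu F] for every [m], and
    [c < a] would force [mu U = 0] in the limit. The powers of [c] stay on one side as factors since
    [c] is only known to be nonnegative. *)
Lemma residue_card_le_scale : a%:R <= c.
Proof.
have [U [oU U0] Udisc] := @Gamma_discrete R n A hA hb.
have mU := open_measurableK oU.
have Un0 : (0 < mu U)%E by apply: mu_open => //; exists 0.
have UF : (mu U <= mu F)%E by apply: packing_le_covering => //; exact: cover_by_Gamma.
have step m : exists P : set K, [/\ measurable (P : set T),
    forall x y, P x -> P y -> Gamma (x - y) -> x = y &
    ((c ^+ m)%:E * mu P = (a%:R ^+ m)%:E * mu U)%E].
  elim: m => [|m [P [mP packP PU]]]; first by exists U; split; rewrite ?expr0.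
  have [P' [mP' packP' PE]] := packing_refine mP packP.
  exists P'; split=> //.
  by rewrite exprSr EFinM -muleA PE muleA -EFinM mulrC EFinM -muleA PU muleA -EFinM -exprS.
pose u := fine (mu U); pose f := fine (mu F).
have fE := tile_measure_fin; rewrite -/f in fE.
have uE : mu U = u%:E.
  by rewrite /u fineK // ge0_fin_numE // (le_lt_trans UF) // fE ltry.
have u0 : 0 < u by move: Un0; rewrite uE lte_fin.
have bound m : a%:R ^+ m * u <= c ^+ m * f.
  have [P [mP packP PU]] := step m.
  have PF : (mu P <= mu F)%E by apply: packing_le_covering => //; exact: cover_by_Gamma.
  rewrite -lee_fin EFinM -uE -PU EFinM -fE.
  by apply: lee_wpmul2l => //; rewrite lee_fin exprn_ge0.
rewrite leNgt; apply/negP => ca.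
have a0 : 0 < a%:R :> R by exact: le_lt_trans ca.
pose r := c / a%:R.
have r1 : `|r| < 1 by rewrite ger0_norm ?divr_ge0 ?(ltW a0) // ltr_pdivrMr // mul1r.
have ubound m : u <= r ^+ m * f.
  rewrite -(ler_pM2l (exprn_gt0 m a0)); apply: le_trans (bound m) _.
  by rewrite mulrA -exprMn /r mulrCA divff ?gt_eqF // mulr1.
have : r ^+ m * f @[m --> \oo] --> (0 : R).
  by rewrite -(mul0r f); apply: cvgM; [exact: (@cvg_expr R)|exact: cvg_cst].
move/cvgr0_norm_lt => /(_ _ u0)[m _ /(_ m (leqnn m))] /=.
by rewrite ltNge (le_trans (ubound m)) ?ler_norm.
Qed.

Lemma translateI X S s : translate X s `&` translate S s = translate (X `&` S) s.
Proof. by rewrite !translateE. Qed.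

(** [A F] remains covered when [X j] is replaced by [X j] minus [X i], so
    [c mu F <= a mu F - mu (X i & X j)], where [&] is intersection. With [a <= c] and [mu F] finite,
    the overlap has measure 0. *)
Lemma digit_translates_null s t : @digitsK R n A hA hb D s -> @digitsK R n A hA hb D t -> s <> t ->
  mu (translate F s `&` translate F t) = 0%E.
Proof.
move=> Ds Dt st; have [g gE] := digits_enum R hA hb hD.
move: Ds Dt; rewrite gE => -[i ia iE] [j ja jE].
have ij : i <> j by move=> ij; apply: st; rewrite -iE -jE ij.
pose X k : set T := translate F (phi (g k)).
have mX k : measurable (X k) by exact: measurable_translate.
pose Y k := if k == j then X j `\` X i else X k.
have mY k : measurable (Y k : set T).
  by rewrite /Y; case: eqP => _; [apply: (@measurableD _ T)|]; exact: mX.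
have FY : actA @` F = \bigcup_(k < a) Y k.
  rewrite (tile_actA hF) gE bigcup_image; apply/seteqP; split=> z [k ka Xz].
    have [kj|kj] := eqVneq k j; last by exists k => //; rewrite /Y (negPf kj).
    have [Xi|Xi] := pselect (X i z); last first.
      by exists k => //; rewrite /Y kj eqxx; split; rewrite -?kj.
    by exists i => //; rewrite /Y; case: eqP.
  by exists k => //; move: Xz; rewrite /Y; case: eqP => // -> [].
pose f := fine (mu F); have fE := tile_measure_fin; rewrite -/f in fE.
have Xf k : mu (X k) = f%:E by rewrite /X mu_translate.
pose x := fine (mu (X i `&` X j)).
have xE : mu (X i `&` X j) = x%:E.
  rewrite /x fineK // ge0_fin_numE // (@le_lt_trans _ _ (mu (X i))) ?Xf ?ltry //.
  by rewrite -(Xf i); apply: measureIl; exact: mX.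
have Yj : mu (Y j) = (f - x)%:E.
  have XD : mu (X j `\` X i) = (mu (X j) - mu (X j `&` X i))%E.
    by apply: measureD; [exact: mX..|rewrite -[X in (X < _)%E]/(mu (X j)) Xf ltry].
  by rewrite /Y eqxx XD Xf setIC xE.
rewrite -iE -jE -[LHS]/(mu (X i `&` X j)) xE.
suff x0 : x <= 0 by congr (_%:E); apply/eqP; rewrite eq_le x0 fine_ge0.
have : (mu (actA @` F) <= \sum_(k < a) mu (Y k))%E.
  by rewrite FY bigcup_mkord; exact: Boole_inequality.
rewrite mu_actA // fE (bigD1 (Ordinal ja)) //= Yj (eq_bigr (fun=> f%:E)); last first.
  by move=> k kj; rewrite /Y ifN ?Xf.
rewrite sumEFin -EFinM -EFinD lee_fin sumr_const cardC1 card_ord => cf.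
have f0 : 0 <= f by rewrite fine_ge0.
have := ler_wpM2r f0 residue_card_le_scale => af.
have := le_trans af cf; rewrite -mulr_natl.
have -> : a%:R = a.-1%:R + 1 :> R by rewrite natr1 prednK // (leq_ltn_trans _ ja).
by rewrite mulrDl mul1r; lra.
Qed.

(** Split off the lowest digits: [F + d + A s'] lies in [A (F + s')]. If the higher parts differ,
    the overlap lies in the image under [A] of a null overlap; if they agree, the lowest digits
    differ and the overlap is a translate of one between two digit tiles. *)
Lemma expansion_translates_null m s t : expansionsK m s -> expansionsK m t -> s <> t ->
  mu (translate F s `&` translate F t) = 0%E.
Proof.
elim: m s t => [|m IH] s t; first by rewrite expansionsK0 => -> ->.
move=> /(expansionsK_inv hD)[d [s' [Dd sm ->]]] /(expansionsK_inv hD)[e [t' [De tm ->]]].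
have mI x y : measurable (translate F x `&` translate F y : set T).
  by apply: measurableI; exact: measurable_translate.
have sub x y : @digitsK R n A hA hb D x -> translate F (x + actA y) `<=` actA @` translate F y.
  move=> Dx _ [w Fw <-].
  have : (\bigcup_(d in @digitsK R n A hA hb D) translate F d) (w + x) by exists x => //; exists w.
  rewrite -(tile_actA hF) => -[w' Fw' E].
  by exists (w' + y); [exists w'|rewrite actAD E addrA].
have [st|st] := pselect (s' = t').
  rewrite st => de; rewrite -!translateD translateI mu_translate //.
  by apply: digit_translates_null => // de'; apply: de; rewrite de'.
move=> _; apply: (@subset_measure0 _ _ _ mu _ (actA @` (translate F s' `&` translate F t'))).
- exact: mI.
- by apply: measurable_actA; exact: mI.
- rewrite actAE preimage_setI -!actAE => z [zs zt].
  by split; [exact: sub zs|exact: sub zt].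
- by have := mu_actA (mI s' t'); rewrite IH // mule0.
Qed.

(** A piece [A^-k (F + d)] of [F] fits inside [W], and it contains the nonempty open set
    [A^-k (U + d)]. Thus [F] has positive measure near each of its points, boundary points
    included. *)
Lemma tile_cap_open_gt0 z W : F z -> open W -> W z -> (0 < mu (F `&` W))%E.
Proof.
move=> Fz oW Wz; have [U [oU [u Uu] UF]] := hU.
have zW : nbhs z W by exact: open_nbhs_nbhs.
have [k _ [d dk dW]] := small_copy hD hF Fz zW.
pose U' : set K := (fun x => iter k actA x - d) @^-1` U.
have oU' : open U'.
  apply: open_comp => // x _.
  apply: (@continuous_comp _ _ _ (iter k actA) (fun x => x - d)); last exact: shiftK_continuous.
  elim: (k) => [|m IH]; first exact: cvg_id.
  by apply: (@continuous_comp _ _ _ (iter m actA) actA); [exact: IH|exact: actA_continuous].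
apply: (lt_le_trans (mu_open oU' _)).
  by exists (iter k actV (u + d)); rewrite /U' /= iter_actVK addrK.
apply: le_measure; rewrite ?inE.
- exact: open_measurableK.
- by apply: measurableI => //; exact: open_measurableK.
- move=> x U'x; split; last first.
    by have := dW _ (UF _ U'x); rewrite subrK iter_actAK.
  have : (\bigcup_(s in expansionsK k) translate F s) (iter k actA x).
    by exists d => //; exists (iter k actA x - d); [exact: UF|rewrite subrK].
  by rewrite -(tile_iter hD hF) => -[x' Fx' /(can_inj (iter_actAK _))<-].
Qed.

Lemma tiling_translate S t : tiling mu F S -> tiling mu F (translate S t).
Proof.
move=> [cov null]; split.
  apply/seteqP; split=> // z _.
  have : (\bigcup_(s in S) translate F s) (z - t) by rewrite cov.
  move=> [s Ss Fz]; exists (s + t); first by exists s.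
  by rewrite -translateD; exists (z - t) => //; rewrite subrK.
move=> _ _ [s Ss <-] [s' Ss' <-] ss'.
rewrite -!translateD translateI mu_translate; last first.
  by apply: measurableI; exact: measurable_translate.
by apply: null => // E; apply: ss'; rewrite E.
Qed.

(** Two elements of [S] lie in a common stage, so their tiles are a common translate of two tiles of
    [F + D_(ik)], whose overlap is null. The translate in question is by [t = - p]. *)
Theorem tile_tilings :
  (exists S : set K, [/\ S `<=` Delta R hA hb D, tiling mu F S &
     exists t : K, atomic F (translate S t) /\
       exists2 k : nat, (1 <= k)%N & self_replicating mu F (translate S t) (iter k actA)]) /\
  (subgroup (Delta R hA hb D) -> tiling mu F (Delta R hA hb D)).
Proof.
have [U [oU U0 UF]] := hU.
have [k k1 [d dk [p Up pE]]] := periodic_point hD hF oU U0 UF.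
pose S := @translations R n A hA hb D k d.
have SD : S `<=` Delta R hA hb D by exact: (translations_Delta hD k1 dk).
have coverS z : exists2 s, S s & translate F s z.
  have [s Ss Fz] := translations_cover hD hF oU UF k1 Up pE (z - p).
  have E : z - p - (s - p) = z - s by rewrite opprB addrA subrK.
  by exists s => //; move: Fz; rewrite !translateE /= E.
have nullS s s' : S s -> S s' -> s <> s' -> mu (translate F s `&` translate F s') = 0%E.
  move=> Ss Ss' ss'; have [i [[e ei eE] [e' e'i e'E]]] := translations_common hD dk Ss Ss'.
  rewrite -eE -e'E -!translateD translateI mu_translate; last first.
    by apply: measurableI; exact: measurable_translate.
  by apply: expansion_translates_null ei e'i _ => ee'; apply: ss'; rewrite -eE -e'E ee'.
have tilS : tiling mu F S.
  by split=> //; apply/seteqP; split=> // z _; have [s] := coverS z; exists s.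
split.
  exists S; split=> //; exists (- p); split; last first.
    exists k => //; split; first exact: tiling_translate.
    move=> s Ss.
    exact: (translations_replicate hD hF pE Ss).
  have Fp : translate F (- p) 0 by exists p; [exact: UF|rewrite subrr].
  exists (- p); split.
    by split=> //; exists 0; [exact: (translations0 hD dk)|rewrite add0r].
  move=> s [[s' Ss' sE] [z Fz zs]].
  (* [0] is interior to [F - p] because [p] lies in the open set [U]. A second tile through [0]
     would meet [U - p], hence the tile [F - p], in positive measure. *)
  apply: contrapT => ps; have [_ null] := tiling_translate (- p) tilS.
  have sS : translate S (- p) s by exists s'.
  have pS : translate S (- p) (- p) by exists 0; [exact: (translations0 hD dk)|rewrite add0r].
  have := null _ _ pS sS ps.
  have -> : translate F (- p) `&` translate F s =
      translate (F `&` translate F (- p - s)) s.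
    by rewrite -translateI translateD subrK setIC.
  rewrite mu_translate; last by apply: measurableI => //; exact: measurable_translate.
  (* The open set [U - p], seen in the coordinates of the tile [F + s]. *)
  pose W : set K := translate U (- p - s).
  have oW : open W.
    by rewrite /W translateE; apply: open_comp => // w _; exact: shiftK_continuous.
  have Wz : W z.
    by exists p => //; rewrite addrA subrr sub0r; apply/eqP; rewrite eq_sym -addr_eq0 zs.
  have := tile_cap_open_gt0 Fz oW Wz => W0 FW0; move: W0; rewrite ltNge -FW0 => /negP; apply.
  apply: le_measure; rewrite ?inE.
  - by apply: measurableI => //; exact: open_measurableK.
  - by apply: measurableI => //; exact: measurable_translate.
  - by apply: setIS => w [x Ux <-]; exists x => //; exact: UF.
move=> [_ DB]; split.
  apply/seteqP; split=> // z _; have [s Ss Fz] := coverS z.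
  by exists s => //; exact: SD.
move=> s s' Ds Ds' ss'.
(* Closure under subtraction gives [s - s' = x - y] with [x], [y] in the same [D_m]; both tiles are
   then moved by the one vector [s' - y] from [F + x] and [F + y]. *)
have /(DeltaP hD)[m _ [x [y [xm ym xyE]]]] := DB _ _ Ds Ds'.
have sE : s = x + (s' - y) by rewrite addrCA -xyE addrC subrK.
have s'E : s' = y + (s' - y) by rewrite addrC subrK.
rewrite sE {2}s'E; move: (s' - y) => t.
rewrite -!translateD translateI mu_translate; last first.
  by apply: measurableI; exact: measurable_translate.
apply: expansion_translates_null xm ym _ => xy; apply: ss'.
by rewrite sE [RHS]s'E xy.
Qed.

End TileMeasure.

(** The results on product measures take measures whose type records sigma-finiteness. An equality
    of measures, rather than agreement on measurable sets, allows substitution in the product of the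
    statement. *)
Lemma sigma_finite_measure_of d (T : measurableType d) (R : realType)
  (m : {measure set T -> \bar R}) : sigma_finite setT m ->
  exists m' : {sigma_finite_measure set T -> \bar R}, m = m'.
Proof.
case: m => m cm sf.
pose m0 : {measure set T -> \bar R} := Measure.Pack cm.
pose m' : {sigma_finite_measure set T -> \bar R} :=
  HB.pack (m0 : set T -> \bar R) (Measure.class m0)
    (Measure_isSigmaFinite.Build _ _ _ m0 sf).
by exists m'.
Qed.

Theorem theorem3p6 (R : realType) (n : nat) (A : 'M[rat]_n.+1)
  (D : set 'cV[rat]_n.+1) (hA : expanding A) (hD : digit_set A D)
  (hb : (2 <= residue_card A^-1)%N)
  (lambda : {measure set (borel 'cV[R]_n.+1) -> \bar R})
  (hlambda : is_lebesgue lambda)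
  (muB : {measure set (borel (completionB R hA hb)) -> \bar R})
  (hmuB : haar muB) (hmuB1 : muB (integersB R hA hb) = 1%E)
  (F : set (KA R hA hb)) (hF : rational_tile D F)
  (hU : exists U : set (KA R hA hb), [/\ open U, U !=set0 & U `<=` F]) :
  let mu : set (KA R hA hb) -> \bar R := (lambda \x muB)%E in
  (exists S : set (KA R hA hb),
     [/\ S `<=` Delta R hA hb D,
         tiling mu F S &
         exists t : KA R hA hb,
           atomic F (translate S t) /\
           exists2 k : nat, (1 <= k)%N &
             self_replicating mu F (translate S t) (iter k actA)]) /\
  (subgroup (Delta R hA hb D) -> tiling mu F (Delta R hA hb D)).
Proof.
have [lam lamE] := sigma_finite_measure_of (lebesgue_sigma_finite hlambda).
have [haarB haarBE] := sigma_finite_measure_of (haar_sigma_finite hmuB hmuB1).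
subst lambda muB => mu.
pose nu : {measure set (borel 'cV[R]_n.+1 * borel (completionB R hA hb))%type -> \bar R} :=
  (lam \x haarB)%E.
have [cF _ _] := hF.
have nu_open V : open V -> V !=set0 -> (0 < nu V)%E.
  exact: (@open_measure_gt0 R n A hA hb lam haarB hlambda hmuB hmuB1 V).
have nuF : (0 < nu F)%E.
  have [U [oU U0 UF]] := hU; apply: (lt_le_trans (nu_open U oU U0)).
  apply: le_measure => //; rewrite inE; first exact: open_measurableK.
  by apply: closed_measurableK; exact: compact_closedK.
(* [F] itself is the compact set of positive measure that normalises the comparison of Haar
   measures. *)
have [c c0 cP] := @actA_scales R n A hA hb lam haarB hlambda hmuB F cF nuF.
apply: (@tile_tilings R n A hA hb nu c) => //.
- by move=> t X; exact: (@product_invariant R n A hA hb lam haarB hlambda hmuB).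
- by move=> X; exact: (@compact_measure_fin R n A hA hb lam haarB hlambda hmuB).
Qed.
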